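(* Let $\mathcal{A}_n$ be the random Apollonian network with $n$ inserted vertices and let $L(n)$ be the length of the longest path in $\mathcal{A}_n$. For any constant $c<2/3$, $$\Pr\left(L(n)\geq n e^{-\log^c n}\right)\leq O\left(e^{-\log^{c/2} n}\right)\qquad (n\to\infty).$$
   Context: Random Apollonian network (ApN): start with a triangle $T_0=xyz$ embedded in the plane. Insert $v_1$ inside $T_0$ and join it to the three vertices of $T_0$, creating 3 triangular faces. In general, after $v_1,\ldots,v_{k}$ have been inserted there are $2k+1$ triangular faces inside $T_0$; choose one of these uniformly at random, independently of the past given the current network, place $v_{k+1}$ inside it, and join it to the three vertices of that face. $\mathcal{A}_n$ is the random plane graph (on $n+3$ vertices) obtained after inserting $v_1,\ldots,v_n$. Paths are simple paths. $\log$ is the natural logarithm and $\log^c n=(\log n)^c$. The constant implied by $O(\cdot)$ may depend on $c$. *)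

(* Defs.v *)
From HB Require Import structures.
From mathcomp Require Import all_boot all_order all_algebra.
From mathcomp Require Import all_classical all_reals all_analysis.

Set Implicit Arguments.
Unset Strict Implicit.
Unset Printing Implicit Defensive.

Import Order.TTheory GRing.Theory Num.Theory.

Local Open Scope ring_scope.

(* The length of a path is its number of edges: [x :: p] is a path of length
   [size p], and it is simple when it has no repeated vertex. *)
Definition longest_path (T : finType) (e : rel T) : nat :=
  (\max_(k < #|T| |
     [exists x : T, exists p : k.-tuple T, path e x p && uniq (x :: p)]) k)%N.

Lemma longest_path_max (T : finType) (e : rel T) (x : T) (p : seq T) :
  path e x p -> uniq (x :: p) -> (size p <= longest_path e)%N.
Proof.
move=> ep up.
have sp : (size p < #|T|)%N.
  by rewrite -[(size p).+1]/(size (x :: p)) -(card_uniqP up) max_card.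
apply: (@bigop.bigmax_sup _ (Ordinal sp)) => //.
by apply/existsP; exists x; apply/existsP; exists (in_tuple p); apply/andP.
Qed.

Lemma longest_path_attained (T : finType) (e : rel T) (x0 : T) :
  exists x p, [/\ path e x p, uniq (x :: p) & size p = longest_path e].
Proof.
have T_gt0 : (0 < #|T|)%N by apply/card_gt0P; exists x0.
have P0 : [exists x : T, exists p : (Ordinal T_gt0).-tuple T,
    path e x p && uniq (x :: p)].
  by apply/existsP; exists x0; apply/existsP; exists [tuple].
rewrite /longest_path (bigop.bigmax_eq_arg (Ordinal T_gt0)) //.
case: arg_maxnP => // k /existsP[x /existsP[p /andP[ep up]]] _.
by exists x, p; split=> //; rewrite size_tuple.
Qed.

(* The vertices are 0, ..., nverts - 1, in order of insertion.  Each edge is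
   listed once, smaller end first.  The plane embedding enters only through the
   triangular faces inside the outer triangle, each listed once as an
   increasing triple. *)
Record network := Network {
  nverts : nat;
  edges : seq (nat * nat);
  faces : seq (nat * nat * nat)
}.

Definition adjacent (A : network) : rel nat :=
  [rel u v | ((u, v) \in edges A) || ((v, u) \in edges A)].

Definition triangle : network :=
  Network 3 [:: (0, 1); (0, 2); (1, 2)]%N [:: (0, 1, 2)%N].

Definition add_vertex (A : network) (f : nat * nat * nat) : network :=
  let: (x, y, z) := f in
  let v := nverts A in
  Network v.+1 [:: (x, v), (y, v), (z, v) & edges A]
    [:: (x, y, v), (x, z, v), (y, z, v) & rem f (faces A)].

Definition longest_path_length (A : network) : nat :=
  longest_path [rel u v : 'I_(nverts A) | adjacent A u v].

(* [apn_expect n F] is the expectation of F(A_n), where A_0, A_1, ... is the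
   Markov chain started at the triangle whose step from A to A' places a new
   vertex in a uniformly random face of A:
   E F(A_(k+1)) = E [ 1/#faces(A_k) * sum_f F(A_k with a vertex in f) ]. *)
Fixpoint apn_expect (R : realType) (n : nat) (F : network -> R) : R :=
  if n is k.+1 then
    apn_expect k
      (fun A => (\sum_(f <- faces A) F (add_vertex A f)) / (size (faces A))%:R)
  else F triangle.

Definition apn_prob (R : realType) (n : nat) (E : pred network) : R :=
  apn_expect n (fun A => (E A)%:R).

Lemma size_faces_add_vertex (A : network) (f : nat * nat * nat) :
  f \in faces A -> size (faces (add_vertex A f)) = (size (faces A)).+2.
Proof. by case: f => [[x y] z] fA /=; rewrite size_rem //; case: (faces A) fA. Qed.

(* Only networks with n + 3 vertices and 2n + 1 inner faces matter. *)
Lemma eq_apn_expect (R : realType) (n : nat) (F G : network -> R) :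
  (forall A, nverts A = n.+3 -> size (faces A) = n.*2.+1 -> F A = G A) ->
  apn_expect n F = apn_expect n G.
Proof.
elim: n F G => [|n IHn] F G FG /=; first exact: FG.
apply: IHn => A vA sA; congr (_ / _); apply: eq_big_seq => f fA.
apply: FG; last by rewrite size_faces_add_vertex // sA doubleS.
by case: f {fA} => [[x y] z] /=; rewrite vA.
Qed.

Lemma apn_prob_total (R : realType) (n : nat) : apn_prob R n predT = 1.
Proof.
rewrite /apn_prob; elim: n => [|n IHn] //=.
rewrite -[RHS]IHn; apply: eq_apn_expect => A _ sA.
by rewrite big_const_seq count_predT iter_addr_0 divff // pnatr_eq0 sA.
Qed.

(* Main.v *)
Require Import Defs.
From HB Require Import structures.
From mathcomp Require Import all_boot all_order all_algebra.
From mathcomp Require Import all_classical all_reals all_analysis.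
From mathcomp Require Import ring lra zify.

Set Implicit Arguments.
Unset Strict Implicit.
Unset Printing Implicit Defensive.

Import Order.TTheory GRing.Theory Num.Theory.
Import numFieldNormedType.Exports.

Local Open Scope classical_set_scope.
Local Open Scope ring_scope.

(** The mean length of the longest path is in fact at most a constant times
n^(1-k) for some k > 0 ([tree_expect_cap_le]); Markov's inequality then gives a
bound exp(log^c n - k log n), far stronger than required for any c < 1.

Subdividing a triangle twice creates nine triangles separated by seven vertices.
A simple path uses each of these vertices at most once, so it visits at most
eight of the nine triangles ([missed_grandchild]). Hence the number of vertices
visited inside a triangle is bounded by its capacity [cap], a function of the
ternary tree of subdivisions, which at every node is the sum of the capacities of
the children minus a quarter of the least capacity two levels below ([path_cap]).

It remains to see that the discounts add up, that is, that the least of nine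
capacities has a mean comparable to the mean capacity. The sizes of the three
subtrees of a random tree with n nodes are dependent. The remedy is to let the
tree grow in continuous time, each leaf splitting at rate one; then, once a
triangle is subdivided, its three subtrees are independent and identically
distributed. Analytically, one passes to exponential generating functions [gf]:
products over the three subtrees turn into products of generating functions, and
the insertion of the first vertex turns into a derivative ([dgf_lift]).

With Y, m, s the generating functions of 1, of the capacity and of its square, one
has Y' = Y^3, m' >= (11/4) m Y^2 and s' <= 3 s Y^2 + 6 m^2 Y. These imply
s Y <= 4 m^2 ([second_moment]), so that the capacity is not much smaller than its
mean with probability bounded below, and so is the minimum of independent copies
([min_lower_bound]). Applied to the capacities of three children and then to the
three resulting minima, this bounds the mean discount below, and
m' <= (3 - k) m Y^2 for some k > 0 ([dgf_cap_lt]). Therefore m <= Y^(3-k), where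
Y = (1 - 2x)^(-1/2), and since the mean capacity increases with n, taking x at
distance of order 1/n from 1/2 yields the bound for trees of size n. *)

(** * Ternary trees and their capacity *)

(** The shape of a network: an inner node is a triangle into which a vertex was
inserted, its children are the three triangles so created, and a leaf is a
face. *)
Inductive tree := Leaf | Node of tree & tree & tree.

(** One entry for each leaf, from left to right. *)
Fixpoint grow (t : tree) : seq tree :=
  if t is Node a b c then
    [seq Node a' b c | a' <- grow a] ++ [seq Node a b' c | b' <- grow b]
      ++ [seq Node a b c' | c' <- grow c]
  else [:: Node Leaf Leaf Leaf].

(** The capacity of a triangle bounds, with one to spare, the number of vertices
that a simple path can visit inside it. At a node the discount is a quarter of
the least of the nine capacities two levels below, because a path misses one of
the nine triangles there. The factor 1/4 is small enough to make the discounts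
at consecutive levels compatible, since they overlap, and to make the capacity
monotone under growth; [missed_child] and [cap_grow] use it. *)
Fixpoint cap {R : realType} (t : tree) : R :=
  if t is Node a b c then
    let min_child t := if t is Node a b c
      then Num.min (cap a) (Num.min (cap b) (cap c)) else 1 in
    cap a + cap b + cap c
      - Num.min (min_child a) (Num.min (min_child b) (min_child c)) / 4
  else 1.

Definition min_child {R : realType} (t : tree) : R :=
  if t is Node a b c then Num.min (cap a) (Num.min (cap b) (cap c)) else 1.

Lemma cap_node (R : realType) (a b c : tree) :
  cap (Node a b c) = cap a + cap b + cap c
    - Num.min (min_child a) (Num.min (min_child b) (min_child c)) / 4 :> R.
Proof. by []. Qed.

(** The form in which linear arithmetic can use a minimum of three reals. *)
Lemma min3P (R : realType) (x y z : R) : exists m : R,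
  [/\ Num.min x (Num.min y z) = m, m <= x, m <= y, m <= z
    & [\/ m = x, m = y | m = z]].
Proof.
exists (Num.min x (Num.min y z)); split=> //.
- by rewrite ge_min lexx.
- by rewrite !ge_min lexx orbT.
- by rewrite !ge_min lexx !orbT.
case: (leP y z) => _; case: leP => _; 
  by [constructor 1|constructor 2|constructor 3].
Qed.

Lemma cap_min_child (R : realType) (t : tree) :
  [/\ 1 <= cap t :> R, 1 <= min_child t :> R & min_child t <= cap t :> R].
Proof.
elim: t => [|a [ca la lca] b [cb lb lcb] c [cc lc lcc]]; first by [].
rewrite cap_node /=.
have [m [-> m1 m2 m3 _]] := min3P (min_child a : R) (min_child b) (min_child c).
have [k [-> k1 k2 k3 k4]] := min3P (cap a : R) (cap b) (cap c).
by split; [lra|case: k4 => ->|lra].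
Qed.

Lemma cap_ge1 (R : realType) (t : tree) : 1 <= cap t :> R.
Proof. by case: (cap_min_child R t). Qed.

Lemma min_child_ge1 (R : realType) (t : tree) : 1 <= min_child t :> R.
Proof. by case: (cap_min_child R t). Qed.

Lemma min_child_le_cap (R : realType) (t : tree) : min_child t <= cap t :> R.
Proof. by case: (cap_min_child R t). Qed.

Fixpoint nleaves (t : tree) : nat :=
  if t is Node a b c then nleaves a + nleaves b + nleaves c else 1.

Lemma cap_le_nleaves (R : realType) (t : tree) : cap t <= (nleaves t)%:R :> R.
Proof.
elim: t => [|a IHa b IHb c IHc]; first by [].
rewrite cap_node /= !natrD.
have [m [-> _ _ _ mE]] := min3P (min_child a : R) (min_child b) (min_child c).
have := min_child_ge1 R a; have := min_child_ge1 R b; have := min_child_ge1 R c.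
by case: mE => ->; lra.
Qed.

HB.instance Definition _ := gen_eqMixin tree.

Lemma min3_lipschitz (R : realType) (x x' y z : R) :
  Num.min x' (Num.min y z) - Num.min x (Num.min y z) <= Num.max 0 (x' - x).
Proof.
have [m [-> mx my mz mE]] := min3P x y z.
have [m' [-> mx' my' mz' _]] := min3P x' y z.
by rewrite le_max; case: mE => E; apply/orP; [right|left|left]; lra.
Qed.

(** Growing a child by one vertex raises the minimum under the discount by at
most the increase of one [min_child], so the second inequality is what keeps the
first one true one level up. It reproduces itself because the discount, a quarter
of at most twice the increase of the child, leaves half of that increase, and
[min_child] of the node rises by at most the whole of it. *)
Lemma cap_grow (R : realType) (t t' : tree) : t' \in grow t ->
  cap t <= cap t' :> R /\ min_child t' - min_child t <= 2 * (cap t' - cap t) :> R.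
Proof.
pose ok (t t' : tree) := cap t <= cap t' :> R /\
  min_child t' - min_child t <= 2 * (cap t' - cap t) :> R.
have step a a' b c : ok a a' -> ok (Node a b c) (Node a' b c).
  move=> [h1 h2]; rewrite /ok !cap_node /=.
  have :=
    min3_lipschitz (min_child a : R) (min_child a') (min_child b) (min_child c).
  have := min3_lipschitz (cap a : R) (cap a') (cap b) (cap c).
  rewrite !le_max => /orP e1 /orP e2.
  by split; case: e1 => e1; case: e2 => e2; lra.
have swap1 a b c : cap (Node a b c) = cap (Node b a c) :> R /\
    min_child (Node a b c) = min_child (Node b a c) :> R.
  by split; [rewrite !cap_node minCA; lra|rewrite /= minCA].
have swap2 a b c : cap (Node a b c) = cap (Node c a b) :> R /\
    min_child (Node a b c) = min_child (Node c a b) :> R.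
  by split; [rewrite !cap_node minA [Num.min _ (min_child c)]minC; lra
            |rewrite /= minA minC].
have trans (u u' w w' : tree) :
    cap u = cap w :> R /\ min_child u = min_child w :> R ->
    cap u' = cap w' :> R /\ min_child u' = min_child w' :> R -> ok w w' -> ok u u'.
  by rewrite /ok => -[-> ->] [-> ->].
elim: t t' => [|a IHa b IHb c IHc] t' /=.
  rewrite inE => /eqP ->.
  by rewrite cap_node /= !minxx; split; lra.
rewrite !mem_cat => /or3P[] /mapP[s s_in ->].
- exact/step/IHa.
- by apply: (trans _ _ _ _ (swap1 _ _ _) (swap1 _ _ _)); apply/step/IHb.
- by apply: (trans _ _ _ _ (swap2 _ _ _) (swap2 _ _ _)); apply/step/IHc.
Qed.

(** * Simple paths miss a triangle two levels down *)

(** A tree whose nodes carry the inserted vertices, so that together with the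
corners of the outermost triangle it determines the graph. *)
Inductive ltree := LLeaf | LNode of nat & ltree & ltree & ltree.

HB.instance Definition _ := gen_eqMixin ltree.

Fixpoint shape (t : ltree) : tree :=
  if t is LNode _ a b c then Node (shape a) (shape b) (shape c) else Leaf.

Definition corners (f : nat * nat * nat) : seq nat :=
  [:: f.1.1; f.1.2; f.2].

Fixpoint inner (t : ltree) : seq nat :=
  if t is LNode v a b c then v :: inner a ++ inner b ++ inner c else [::].

Fixpoint lfaces (f : nat * nat * nat) (t : ltree) : seq (nat * nat * nat) :=
  if t is LNode v a b c then
    let: (x, y, z) := f in
    lfaces (x, y, v) a ++ lfaces (x, z, v) b ++ lfaces (y, z, v) c
  else [:: f].

Fixpoint ledges (f : nat * nat * nat) (t : ltree) : seq (nat * nat) :=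
  if t is LNode v a b c then
    let: (x, y, z) := f in
    [:: (x, v), (y, v), (z, v) & ledges (x, y, v) a
      ++ ledges (x, z, v) b ++ ledges (y, z, v) c]
  else [::].

Definition simple_region f t := uniq (corners f ++ inner t).

(** Edges of [E] meet the inside of the triangle only as edges of its own
subdivision: this is how planarity enters, without any embedding. *)
Definition sealed (E : seq (nat * nat)) f t :=
  forall e, e \in E -> (e.1 \in inner t) || (e.2 \in inner t) ->
    e \in ledges f t.

Lemma ledges_ends f t e : e \in ledges f t ->
  (e.1 \in corners f ++ inner t) && (e.2 \in corners f ++ inner t).
Proof.
elim: t f => // v a IHa b IHb c IHc [[x y] z] /=.
rewrite !inE => /or4P[/eqP->|/eqP->|/eqP->|] /=; rewrite ?eqxx ?orbT //.
rewrite !mem_cat => /or3P[/IHa|/IHb|/IHc];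
  rewrite !mem_cat !inE => /andP[];
  by do 2 (move=> /orP[/or3P[]|] ->; rewrite ?orbT //).
Qed.

Section Children.
Variables (E : seq (nat * nat)) (x y z v : nat) (a b c : ltree).
Hypothesis nodeS : simple_region (x, y, z) (LNode v a b c).
Hypothesis nodeE : sealed E (x, y, z) (LNode v a b c).

Lemma region_count u : (count_mem u [:: x; y; z; v] + count_mem u (inner a)
  + count_mem u (inner b) + count_mem u (inner c) <= 1)%N.
Proof.
have := count_uniq_mem u nodeS; rewrite /= !count_cat.
by case: (_ \in _); lia.
Qed.

Lemma simple_children : [/\ simple_region (x, y, v) a,
  simple_region (x, z, v) b & simple_region (y, z, v) c].
Proof.
have aux s : (forall u, count_mem u s <= count_mem u [:: x; y; z; v]
  + count_mem u (inner a) + count_mem u (inner b) + count_mem u (inner c))%N ->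
  uniq s.
  move=> h; apply: count_mem_uniq => u; have := leq_trans (h u) (region_count u).
  by rewrite -has_pred1 has_count; case: (count_mem u s) => [|[]].
by split; apply: aux => u /=; lia.
Qed.

Lemma region_mem u : ((u \in [:: x; y; z; v]) + (u \in inner a)
  + (u \in inner b) + (u \in inner c) <= 1)%N.
Proof.
have aux (s : seq nat) : ((u \in s) <= count_mem u s)%N.
  by rewrite -has_pred1 has_count; case: count.
by apply: leq_trans (region_count u); rewrite !leq_add.
Qed.

Lemma sealed_children : [/\ sealed E (x, y, v) a,
  sealed E (x, z, v) b & sealed E (y, z, v) c].
Proof.
have star e : e \in [:: (x, v); (y, v); (z, v)] ->
    (e.1 \in [:: x; y; z; v]) && (e.2 \in [:: x; y; z; v]).
  by rewrite !inE => /or3P[] /eqP -> /=; rewrite !eqxx ?orbT.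
have child f t e (ft : {subset corners f <= [:: x; y; z; v]}) :
    e \in ledges f t ->
    ((e.1 \in [:: x; y; z; v]) || (e.1 \in inner t)) &&
    ((e.2 \in [:: x; y; z; v]) || (e.2 \in inner t)).
  move=> /ledges_ends; rewrite !mem_cat => /andP[h1 h2].
  by apply/andP; split; [case/orP: h1|case/orP: h2] => h;
     rewrite ?h ?orbT ?ft.
have fa : {subset corners (x, y, v) <= [:: x; y; z; v]}.
  by move=> u; rewrite !inE => /or3P[] ->; rewrite ?orbT.
have fb : {subset corners (x, z, v) <= [:: x; y; z; v]}.
  by move=> u; rewrite !inE => /or3P[] ->; rewrite ?orbT.
have fc : {subset corners (y, z, v) <= [:: x; y; z; v]}.
  by move=> u; rewrite !inE => /or3P[] ->; rewrite ?orbT.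
have cases e : e \in E -> [|| e.1 \in inner a, e.1 \in inner b | e.1 \in inner c]
    || [|| e.2 \in inner a, e.2 \in inner b | e.2 \in inner c] ->
    [|| e \in [:: (x, v); (y, v); (z, v)], e \in ledges (x, y, v) a,
        e \in ledges (x, z, v) b | e \in ledges (y, z, v) c].
  move=> eE ue; have: e \in ledges (x, y, z) (LNode v a b c).
    apply: nodeE eE _; rewrite /= !in_cons !mem_cat.
    by case/orP: ue => ->; rewrite ?orbT.
  by rewrite /= !in_cons !mem_cat in_nil orbF -!orbA.
split=> e eE ue; have m1 := region_mem e.1; have m2 := region_mem e.2.
all: have := cases e eE ltac:(by case/orP: ue => ->; rewrite ?orbT).
all: case/or4P => h; try exact: h.
all: exfalso; move: ue m1 m2.
all: first [have := star _ h|have := child _ _ _ fa h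
  |have := child _ _ _ fb h|have := child _ _ _ fc h].
all: by clear h; do 8 case: (_ \in _).
Qed.

End Children.

(** If the regions [Gs] are separated from each other by [S], then between
visits to two of them a path must use a vertex of [S]; hence a path hits at most
one region more than it has vertices in [S]. *)
Section Hits.
Variables (T : eqType) (adj : rel T) (S : seq T) (Gs : seq (seq T)).
Hypothesis closed_off : forall G u w,
  G \in Gs -> u \in G -> adj u w -> (w \in G) || (w \in S).
Hypothesis disj : uniq (S ++ flatten Gs).

Lemma count_mem_flatten u :
  (count (fun G => u \in G) Gs <= (u \notin S))%N.
Proof.
have aux Hs : (count (fun G => u \in G) Hs <= count_mem u (flatten Hs))%N.
  elim: Hs => //= G Hs IH; rewrite count_cat leq_add //.
  by rewrite -has_pred1 has_count; case: count.
apply: leq_trans (aux _) _.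
have := count_uniq_mem u disj; rewrite count_cat mem_cat.
have : (count_mem u S == 0%N) = (u \notin S).
  by rewrite -has_pred1 has_count lt0n negbK.
case: (u \in S) => /=; case: (count_mem u S) => //=; first by lia.
by case: (u \in flatten Gs); lia.
Qed.

(** The correction term makes the bound hereditary: a path that starts in [S]
hits no more regions than it has vertices in [S]. *)
Lemma count_hit p : sorted adj p ->
  (count (fun G => has (mem G) p) Gs
     <= count (mem S) p + (if p is x :: _ then x \notin S else 0))%N.
Proof.
elim: p => [|x p IHp] /=; first by rewrite (@eq_count _ _ pred0) ?count_pred0.
move=> xp; have {}IHp := IHp (path_sorted xp).
have hitU : (count (fun G => (x \in G) || has (mem G) p) Gs <=
    count (fun G => x \in G) Gs + count (fun G => has (mem G) p) Gs)%N.
  by rewrite -count_predUI leq_addr.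
have xS := count_mem_flatten x.
have [xinS|xninS] /= := boolP (x \in S).
  apply: leq_trans hitU _.
  rewrite xinS leqn0 in xS; rewrite (eqP xS) add0n addn0 add1n.
  apply: leq_trans IHp _; rewrite -addn1 leq_add2l.
  by case: (p) => //= y q; exact: leq_b1.
rewrite add0n addn1; rewrite xninS in xS.
case: p xp IHp hitU => [_ _|y q /= /andP[xy _] IHq] hitU.
  apply: leq_trans hitU _.
  by rewrite (@eq_count _ (fun G => has (mem G) [::]) pred0) // count_pred0 addn0.
have [yS|yS] := boolP (y \in S).
  by apply: leq_trans hitU _; rewrite -add1n leq_add // (leq_trans IHq) // yS addn0.
have xy_same : {in Gs, (fun G => [|| x \in G, y \in G | has (mem G) q])
    =1 (fun G => (y \in G) || has (mem G) q)}.
  move=> G GGs /=; have [xG|//] := boolP (x \in G).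
  by have := closed_off GGs xG xy; rewrite (negPf yS) orbF => ->.
by rewrite (eq_in_count xy_same) (leq_trans IHq) // yS (negPf yS) addn1.
Qed.
End Hits.

Section PathCap.
Variables (R : realType) (E : seq (nat * nat)) (p : seq nat).
Let adj : rel nat := [rel u w | ((u, w) \in E) || ((w, u) \in E)].
Hypothesis p_uniq : uniq p.
Hypothesis p_path : sorted adj p.

Lemma sealed_adj f t u w : sealed E f t -> u \in inner t -> adj u w ->
  (w \in inner t) || (w \in corners f).
Proof.
move=> sE ut /orP[] /sE /=; rewrite ut ?orbT => /(_ isT) /ledges_ends /andP[];
  by rewrite !mem_cat orbC => *; rewrite // orbC.
Qed.

Let visits (t : ltree) : R := (count (mem (inner t)) p)%:R.

Lemma visits_node v a b c :
  visits (LNode v a b c) <= 1 + visits a + visits b + visits c.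
Proof.
rewrite /visits -[1]/(1%:R) -!natrD ler_nat.
have cU (s1 s2 : seq nat) : (count (mem (s1 ++ s2)) p <=
    count (mem s1) p + count (mem s2) p)%N.
  rewrite -count_predUI (@eq_count _ _ (predU (mem s1) (mem s2))) ?leq_addr //.
  by move=> u /=; rewrite mem_cat.
rewrite /= -cat1s -!addnA.
apply: leq_trans (cU _ _) _; apply: leq_add.
  rewrite (@eq_count _ _ (pred1 v)) ?count_uniq_mem ?leq_b1 //.
  by move=> u /=; rewrite inE.
by apply: leq_trans (cU _ _) _; rewrite leq_add2l.
Qed.

Lemma visits0 t : ~~ has (mem (inner t)) p -> visits t = 0.
Proof. by rewrite /visits has_count -eqn0Ngt => /eqP ->. Qed.

(** Seven vertices, namely the three corners, the inserted vertex and the three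
vertices inserted next, separate the nine triangles two levels down. A simple
path uses each of them at most once, so it hits at most eight triangles. *)
Lemma missed_grandchild x y z v va a1 a2 a3 vb b1 b2 b3 vc c1 c2 c3 :
  let t := LNode v (LNode va a1 a2 a3) (LNode vb b1 b2 b3) (LNode vc c1 c2 c3) in
  simple_region (x, y, z) t -> sealed E (x, y, z) t ->
  has (fun s => visits s == 0) [:: a1; a2; a3; b1; b2; b3; c1; c2; c3].
Proof.
move=> t tS tE.
have [aE bE cE] := sealed_children tS tE.
have [aS bS cS] := simple_children tS.
have [a1E a2E a3E] := sealed_children aS aE.
have [b1E b2E b3E] := sealed_children bS bE.
have [c1E c2E c3E] := sealed_children cS cE.
pose S := [:: x; y; z; v; va; vb; vc].
pose Gs := map inner [:: a1; a2; a3; b1; b2; b3; c1; c2; c3].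
have closed_off (G : seq nat) u w : G \in Gs -> u \in G -> adj u w ->
    (w \in G) || (w \in S).
  move=> GGs uG uw.
  have aux f s : sealed E f s -> {subset corners f <= S} -> G = inner s ->
      (w \in G) || (w \in S).
    move=> sE fS Gs_; move: uG; rewrite Gs_ => us.
    by case/orP: (sealed_adj sE us uw) => [->//|/fS ->]; rewrite orbT.
  rewrite !inE in GGs; move: GGs.
  case/orP => [/eqP|/or4P[/eqP|/eqP|/eqP|]].
  5: case/or4P => [/eqP|/eqP|/eqP|/orP[] /eqP].
  1-9: first [apply: (aux _ _ a1E _)|apply: (aux _ _ a2E _)
    |apply: (aux _ _ a3E _)|apply: (aux _ _ b1E _)|apply: (aux _ _ b2E _)
    |apply: (aux _ _ b3E _)|apply: (aux _ _ c1E _)|apply: (aux _ _ c2E _)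
    |apply: (aux _ _ c3E _)].
  1-9: by move=> k; rewrite !inE => /or3P[] ->; rewrite ?orbT.
have disj : uniq (S ++ flatten Gs).
  rewrite -(perm_uniq (s1 := corners (x, y, z) ++ inner t)) //.
  apply/permP => P; rewrite /t /S /Gs; do 4 rewrite /= ?count_cat; ring.
have := count_hit closed_off disj p_path.
have cS7 : (count (mem S) p <= 7)%N.
  rewrite -size_filter; apply: (@uniq_leq_size _ _ S); first exact: filter_uniq.
  by move=> u; rewrite mem_filter => /andP[].
move=> hit.
apply: contraT; rewrite -all_predC => /allP nohit.
suff h9 : count (fun G => has (mem G) p) Gs = 9%N.
  by move: hit; rewrite h9; case: (p) cS7 => [|u q]; [lia|case: (_ \notin _); lia].
rewrite -[RHS]/(size Gs); apply/eqP; rewrite -all_count.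
apply/allP => G /mapP[s sin ->]; have /= := nohit _ sin.
by apply: contraR => /visits0 ->.
Qed.

(** A path that misses a child of [a] altogether leaves three quarters of the
capacity of that child unused: the quarter given up is the discount already
included in the capacity of [a], which is at most a quarter of the capacity of
the missed child. *)
Lemma missed_child va a1 a2 a3 (a := LNode va a1 a2 a3) :
  (forall s, s \in [:: a1; a2; a3] -> visits s + 1 <= cap (shape s)) ->
  has (fun s => visits s == 0) [:: a1; a2; a3] ->
  visits a <= cap (shape a) - min_child (shape a) * (3 / 4) - 1.
Proof.
move=> IH; have := visits_node va a1 a2 a3.
rewrite -/a [shape _]/= cap_node /=.
have [k [-> k1 k2 k3 _]] :=
  min3P (cap (shape a1) : R) (cap (shape a2)) (cap (shape a3)).
have [l [-> l1 l2 l3 _]] :=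
  min3P (min_child (shape a1) : R) (min_child (shape a2)) (min_child (shape a3)).
have := IH a1; have := IH a2; have := IH a3; rewrite !inE !eqxx !orbT.
move=> /(_ isT) ? /(_ isT) ? /(_ isT) ?.
have := min_child_le_cap R (shape a1); have := min_child_le_cap R (shape a2).
have := min_child_le_cap R (shape a3).
by rewrite orbF => ? ? ? ? /or3P[] /eqP; lra.
Qed.

(** The claim for the children is carried along because the induction step looks
two levels down. *)
Lemma path_cap_children t f : simple_region f t -> sealed E f t ->
  visits t + 1 <= cap (shape t) /\
  forall s, (if t is LNode _ a b c then s \in [:: a; b; c] else false) ->
    visits s + 1 <= cap (shape s).
Proof.
elim: t f => [|v a IHa b IHb c IHc] [[x y] z] tS tE.
  by split=> //; rewrite /visits /= (@eq_count _ _ pred0) // count_pred0 add0r.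
have [aE bE cE] := sealed_children tS tE.
have [aS bS cS] := simple_children tS.
have [{}IHa IHa'] := IHa _ aS aE; have [{}IHb IHb'] := IHb _ bS bE.
have [{}IHc IHc'] := IHc _ cS cE.
split; last by move=> s; rewrite !inE => /or3P[] /eqP ->.
have vT := visits_node v a b c.
rewrite [shape _]/= cap_node.
have [m [-> ma mb mc _]] :=
  min3P (min_child (shape a) : R) (min_child (shape b)) (min_child (shape c)).
(* If some child is a leaf then m <= 1, and the slack of one unit in the bounds
   for the three children pays for the discount. *)
have [m1|m_gt1] := lerP m 1; first by lra.
suff : [\/ visits a <= cap (shape a) - min_child (shape a) * (3 / 4) - 1,
    visits b <= cap (shape b) - min_child (shape b) * (3 / 4) - 1
  | visits c <= cap (shape c) - min_child (shape c) * (3 / 4) - 1].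
  by case=> ?; lra.
case: a b c {IHa IHb IHc} ma mb mc tS tE IHa' IHb' IHc' {vT aE bE cE aS bS cS}
  => [|va a1 a2 a3] [|vb b1 b2 b3] [|vc c1 c2 c3] ma mb mc tS tE Ha Hb Hc;
  try by [rewrite /= in ma; lra|rewrite /= in mb; lra|rewrite /= in mc; lra].
have := missed_grandchild tS tE.
rewrite -[[:: a1, a2, a3 & _]]/([:: a1; a2; a3] ++ [:: b1; b2; b3]
  ++ [:: c1; c2; c3]).
rewrite !has_cat => /or3P[].
- by constructor 1; exact: missed_child.
- by constructor 2; exact: missed_child.
- by constructor 3; exact: missed_child.
Qed.

Lemma path_cap t f : simple_region f t -> sealed E f t ->
  visits t + 1 <= cap (shape t).
Proof. by move=> tS /(path_cap_children tS)[]. Qed.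
End PathCap.

(** * From networks to trees *)

(** The faces of the triangle [f] subdivided by [t], each with the tree obtained
by inserting [v] into it. *)
Fixpoint lgrow (v : nat) (f : nat * nat * nat) (t : ltree) :
    seq ((nat * nat * nat) * ltree) :=
  if t is LNode u a b c then
    let: (x, y, z) := f in
    [seq (p.1, LNode u p.2 b c) | p <- lgrow v (x, y, u) a]
    ++ [seq (p.1, LNode u a p.2 c) | p <- lgrow v (x, z, u) b]
    ++ [seq (p.1, LNode u a b p.2) | p <- lgrow v (y, z, u) c]
  else [:: (f, LNode v LLeaf LLeaf LLeaf)].

Lemma lgrow_faces v f t : map fst (lgrow v f t) = lfaces f t.
Proof.
elim: t f => // u a IHa b IHb c IHc [[x y] z] /=.
by rewrite !map_cat -IHa -IHb -IHc -!map_comp.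
Qed.

Lemma lgrow_shape v f t :
  map (fun p => shape p.2) (lgrow v f t) = grow (shape t).
Proof.
elim: t f => // u a IHa b IHb c IHc [[x y] z] /=.
rewrite !map_cat -(IHa (x, y, u)) -(IHb (x, z, u)) -(IHc (y, z, u)).
by rewrite -!map_comp.
Qed.

Definition new_faces (v : nat) (f : nat * nat * nat) :=
  let: (x, y, z) := f in [:: (x, y, v); (x, z, v); (y, z, v)].

Definition new_edges (v : nat) (f : nat * nat * nat) :=
  let: (x, y, z) := f in [:: (x, v); (y, v); (z, v)].

Lemma lgrow_perm v f t p : p \in lgrow v f t ->
  [/\ perm_eq (p.1 :: lfaces f p.2) (new_faces v p.1 ++ lfaces f t),
      perm_eq (ledges f p.2) (new_edges v p.1 ++ ledges f t)
    & perm_eq (inner p.2) (v :: inner t)].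
Proof.
suff H : p \in lgrow v f t -> [/\ forall P, count P (p.1 :: lfaces f p.2)
      = count P (new_faces v p.1 ++ lfaces f t),
      forall P, count P (ledges f p.2) = count P (new_edges v p.1 ++ ledges f t)
    & forall P, count P (inner p.2) = count P (v :: inner t)].
  by move=> /H[? ? ?]; split; apply/permP.
elim: t f p => [|u a IHa b IHb c IHc] [[x y] z] p.
  rewrite inE => /eqP -> /=; split=> P /=; ring.
rewrite [lgrow _ _ _]/= !mem_cat => /or3P[] /mapP[[g s] sin ->].
all: first [case: (IHa _ _ sin)|case: (IHb _ _ sin)|case: (IHc _ _ sin)].
all: case: g sin => [[gx gy] gz] sin H1 H2 H3;
  split=> P; [move: (H1 P)|move: (H2 P)|move: (H3 P)].
all: rewrite /= ?count_cat /= ?count_cat.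
all: repeat match goal with |- context [count ?P ?s] =>
  move: (count P s) => ? end.
all: repeat match goal with |- context [nat_of_bool ?b] =>
  move: (nat_of_bool b) => ? end.
all: lia.
Qed.

Definition represents (A : network) (t : ltree) :=
  [/\ perm_eq (faces A) (lfaces (0, 1, 2)%N t),
      edges A =i edges triangle ++ ledges (0, 1, 2)%N t,
      perm_eq (inner t) (iota 3 (size (inner t)))
    & nverts A = (size (inner t)).+3].

Lemma represents_add_vertex A t p : represents A t ->
  p \in lgrow (nverts A) (0, 1, 2)%N t -> represents (add_vertex A p.1) p.2.
Proof.
move=> [At Et It nA] pin.
have [Fp Ep Ip] := lgrow_perm pin.
have fin : p.1 \in faces A.
  by rewrite (perm_mem At) -(lgrow_faces (nverts A)) map_f.
have Sp : size (inner p.2) = (size (inner t)).+1 by rewrite (perm_size Ip).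
split.
- rewrite -(perm_cons p.1) perm_sym (perm_trans Fp) //.
  case: (p.1) fin => [[x y] z] fin /=.
  rewrite -[_ :: _ :: _ :: _ :: _]/([:: (x, y, z)]
    ++ new_faces (nverts A) (x, y, z) ++ rem (x, y, z) (faces A)).
  rewrite perm_sym perm_catCA perm_cat2l perm_sym.
  rewrite (perm_trans _ (perm_to_rem fin)) //.
  by rewrite perm_sym.
- have -> : edges (add_vertex A p.1) = new_edges (nverts A) p.1 ++ edges A.
    by case: (p.1) => [[]].
  by move=> e; rewrite mem_cat Et !mem_cat (perm_mem Ep) mem_cat orbCA.
- have -> : iota 3 (size (inner p.2)) = iota 3 (size (inner t)) ++ [:: nverts A].
    by rewrite Sp nA -(addn1 (size _)) iotaD addn1 -add3n.
  by rewrite (perm_trans Ip) // -cat1s perm_catC perm_cat2r.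
- by rewrite Sp; case: (p.1) => [[x y] z] /=; rewrite nA.
Qed.

(** Expectation for the random tree with [n] nodes, in which a uniformly random
leaf is split at each step. *)
Fixpoint tree_expect {R : realType} (n : nat) (F : tree -> R) : R :=
  if n is k.+1 then
    tree_expect k (fun t => (\sum_(s <- grow t) F s) / (size (grow t))%:R)
  else F Leaf.

(** A uniformly random face of a network is a uniformly random leaf of its tree,
so the two chains can be run together. *)
Lemma apn_expect_le_tree_expect (R : realType) (n : nat) (F : network -> R)
    (G : tree -> R) :
  (forall A t, represents A t -> F A <= G (shape t)) ->
  apn_expect n F <= tree_expect n G.
Proof.
elim: n F G => [|n IHn] F G FG /=.
  by apply: (FG triangle LLeaf); split=> // e; rewrite [ledges _ _]/= cats0.
apply: IHn => A t At.
have [Fa _ _ _] := At.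
rewrite -(lgrow_shape (nverts A) (0, 1, 2)%N t) size_map.
rewrite (perm_size Fa) -(lgrow_faces (nverts A)) size_map.
rewrite ler_wpM2r ?invr_ge0 // (perm_big _ Fa) -(lgrow_faces (nverts A)).
rewrite /= !big_map big_seq [leRHS]big_seq; apply: ler_sum => p pin.
by apply: FG; exact: represents_add_vertex At pin.
Qed.

(** Only the three outer vertices are not counted by the capacity. *)
Lemma longest_path_le_cap (R : realType) A t : represents A t ->
  (longest_path_length A)%:R <= cap (shape t) + 1 :> R.
Proof.
move=> [At Et It nA]; rewrite /longest_path_length.
have x0 : 'I_(nverts A) by rewrite nA; exact: ord0.
have [x [p [pe pu <-]]] :=
  longest_path_attained [rel u v : 'I_(nverts A) | Defs.adjacent A u v] x0.
pose q := map val (x :: p).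
have q_uniq : uniq q by rewrite map_inj_uniq //; exact: val_inj.
have q_path : sorted (Defs.adjacent A) q by rewrite /= path_map.
have region : simple_region (0, 1, 2)%N t.
  rewrite /simple_region (perm_uniq (perm_cat (perm_refl _) It)).
  exact: (iota_uniq 0 (3 + size (inner t))).
have inner3 u : u \in inner t -> (3 <= u)%N.
  by rewrite (perm_mem It) mem_iota => /andP[].
have seal : sealed (edges A) (0, 1, 2)%N t.
  move=> e; rewrite Et mem_cat => /orP[|//].
  by rewrite !inE => /or3P[] /eqP -> /= /orP[] /inner3.
have := path_cap R q_uniq q_path region seal.
have : (size q <= 3 + count (mem (inner t)) q)%N.
  rewrite -(count_predC (mem (inner t)) q) addnC leq_add2r.
  rewrite -size_filter -[3%N]/(size [:: 0; 1; 2]%N).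
  apply: uniq_leq_size; first exact: filter_uniq.
  move=> u; rewrite mem_filter /= (perm_mem It) mem_iota => /andP[ui].
  move=> /mapP[w _ uw]; have : (u < nverts A)%N by rewrite uw /=.
  by rewrite nA; move: ui; case: u {uw} => [|[|[|u]]] //=; lia.
rewrite size_map /= -(ler_nat R) natrD -[(size p).+1]addn1 natrD => h1 h2.
lra.
Qed.

(** * Products and derivatives of power series *)

Section PowerSeries.
Variable R : realType.
Implicit Types u v : R ^nat.

Definition cauchy_prod u v : R ^nat := fun n => \sum_(i < n.+1) u i * v (n - i)%N.

Lemma cauchy_prod_ge0 u v : (forall n, 0 <= u n) -> (forall n, 0 <= v n) ->
  forall n, 0 <= cauchy_prod u v n.
Proof. by move=> u0 v0 n; apply: sumr_ge0 => i _; rewrite mulr_ge0. Qed.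

(** The product rule, coefficient by coefficient; it is read off the product rule
for truncating polynomials. *)
Lemma pseries_diffs_cauchy_prod u v n : pseries_diffs (cauchy_prod u v) n =
  cauchy_prod (pseries_diffs u) v n + cauchy_prod u (pseries_diffs v) n.
Proof.
pose p := \poly_(i < n.+2) u i; pose q := \poly_(i < n.+2) v i.
have pE i : (i < n.+2)%N -> p`_i = u i by move=> h; rewrite coef_poly h.
have qE i : (i < n.+2)%N -> q`_i = v i by move=> h; rewrite coef_poly h.
have := congr1 (fun f : {poly R} => f`_n) (derivM p q).
rewrite coefD coef_deriv !coefM => dE.
transitivity ((\sum_(j < n.+2) p`_j * q`_(n.+1 - j)) *+ n.+1).
  rewrite /pseries_diffs /cauchy_prod mulr_natl; congr (_ *+ _).
  by apply: eq_bigr => i _; rewrite pE // qE // ltnS leq_subr.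
rewrite dE; congr (_ + _); apply: eq_bigr => i _.
  rewrite coef_deriv /pseries_diffs mulr_natl pE; last by rewrite ltnS ltn_ord.
  by rewrite qE // (leq_ltn_trans (leq_subr _ _)).
rewrite coef_deriv /pseries_diffs mulr_natl pE; last first.
  by rewrite ltnW // ltnS ltn_ord.
by rewrite qE // ltnS ltnS leq_subr.
Qed.

Lemma series_cauchy_prod u v n :
  series (cauchy_prod u v) n = \sum_(i < n) u i * series v (n - i)%N.
Proof.
elim: n => [|n IHn]; first by rewrite /series /= big_geq // big_ord0.
rewrite seriesSr IHn /cauchy_prod !big_ord_recr /= subnn subSnn !seriesSr.
rewrite [series v 0]/series /= big_geq // add0r addrA; congr (_ + _).
rewrite -big_split /=; apply: eq_bigr => i _.
by rewrite -mulrDr subSn 1?ltnW // seriesSr.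
Qed.

(** For nonnegative terms, the partial sums of the Cauchy product lie between the
products of the partial sums over a square of half the side and the product of
the limits. *)
Lemma cvg_series_cauchy_prod u v (U V : R) :
  (forall n, 0 <= u n) -> (forall n, 0 <= v n) ->
  series u @ \oo --> U -> series v @ \oo --> V ->
  series (cauchy_prod u v) @ \oo --> U * V.
Proof.
move=> u0 v0 uU vV.
have ndu : nondecreasing_seq (series u) by exact: nondecreasing_series.
have ndv : nondecreasing_seq (series v) by exact: nondecreasing_series.
have ndc : nondecreasing_seq (series (cauchy_prod u v)).
  by apply: nondecreasing_series => n _ _; exact: cauchy_prod_ge0.
have leU n : series u n <= U.
  rewrite -(cvg_lim (@Rhausdorff R) uU).
  by apply: nondecreasing_cvgn_le => //; exact: cvgP uU.
have leV n : series v n <= V.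
  rewrite -(cvg_lim (@Rhausdorff R) vV).
  by apply: nondecreasing_cvgn_le => //; exact: cvgP vV.
have su0 n : 0 <= series u n by exact: sumr_ge0.
have sv0 n : 0 <= series v n by exact: sumr_ge0.
have V0 : 0 <= V := le_trans (sv0 0%N) (leV 0%N).
have ub n : series (cauchy_prod u v) n <= U * V.
  rewrite series_cauchy_prod (le_trans (y := series u n * V)) ?ler_wpM2r //.
  rewrite /series /= big_mkord mulr_suml; apply: ler_sum => i _.
  by rewrite ler_wpM2l //; exact: leV.
have lb n : series u n * series v n <= series (cauchy_prod u v) (n + n)%N.
  rewrite series_cauchy_prod /series /= big_mkord mulr_suml big_split_ord /=.
  rewrite -[leLHS]addr0 lerD ?sumr_ge0 //; last first.
    by move=> i _; rewrite mulr_ge0 //; exact: sv0.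
  apply: ler_sum => i _; rewrite ler_wpM2l //.
  have ni : (n <= n + n - i)%N by rewrite -addnBA ?leq_addr // ltnW.
  exact: (ndv _ _ ni).
have cc : cvgn (series (cauchy_prod u v)).
  by apply: nondecreasing_is_cvgn => //; exists (U * V) => _ [n _ <-].
suff <- : limn (series (cauchy_prod u v)) = U * V by [].
apply/eqP; rewrite eq_le; apply/andP; split.
  by apply: limr_le => //; exact: nearW.
have uvUV : (fun n => series u n * series v n) @ \oo --> U * V.
  exact: (cvgM uU vV).
apply: (cvgr_to_le uvUV); apply: nearW => n.
by rewrite (le_trans (lb n)) //; exact: nondecreasing_cvgn_le.
Qed.

Lemma pseries_cauchy_prod u v (x : R) : 0 <= x ->
  (forall n, 0 <= u n) -> (forall n, 0 <= v n) ->
  cvgn (pseries u x) -> cvgn (pseries v x) ->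
  cvgn (pseries (cauchy_prod u v) x) /\
  limn (pseries (cauchy_prod u v) x) = limn (pseries u x) * limn (pseries v x).
Proof.
move=> x0 u0 v0 cu cv.
have -> : pseries (cauchy_prod u v) x =
    series (cauchy_prod (fun i => u i * x ^+ i) (fun i => v i * x ^+ i)).
  rewrite /pseries; congr series; apply/funext => n.
  rewrite /cauchy_prod /= mulr_suml; apply: eq_bigr => i _.
  by rewrite mulrACA -exprD subnKC // -ltnS.
have ge0 w : (forall n, 0 <= w n) -> forall n, 0 <= w n * x ^+ n.
  by move=> w0 n; rewrite mulr_ge0 ?exprn_ge0.
have := cvg_series_cauchy_prod (ge0 _ u0) (ge0 _ v0) cu cv.
by move=> c; split; [exact: cvgP c|exact: cvg_lim c].
Qed.

(** Radius of convergence at least 1/2, in a form that is visibly stable under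
termwise differentiation and domination. *)
Definition tame u := forall r, 0 <= r -> r < 1 / 2 ->
  exists C, forall n, `|u n| * r ^+ n <= C.

Lemma tame_cvg u x : tame u -> `|x| < 1 / 2 -> cvgn (pseries u x).
Proof.
move=> tu xlt; pose r := (`|x| + 1 / 2) / 2.
have r0 : 0 < r by rewrite /r; have := normr_ge0 x; lra.
have [C uC] := tu r (ltW r0) ltac:(rewrite /r; lra).
have C0 : 0 <= C by rewrite (le_trans _ (uC 0%N)) // expr0 mulr1.
apply: normed_cvg.
pose g n := C * (`|x| / r) ^+ n.
have xr : `|x| / r < 1 by rewrite ltr_pdivrMr // mul1r /r; lra.
have xr0 : 0 <= `|x| / r by rewrite divr_ge0 // ltW.
apply: (@series_le_cvg _ _ g) => //.
- by move=> n /=.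
- by move=> n; apply: mulr_ge0; rewrite ?exprn_ge0.
- move=> n /=; rewrite normrM normrX /g.
  rewrite exprMn exprVn mulrA ler_pdivlMr ?exprn_gt0 //.
  by rewrite mulrAC ler_wpM2r ?exprn_ge0.
- by apply: (@is_cvg_geometric_series _ C); rewrite ger0_norm.
Qed.

Lemma geometric_bound (q : R) n : 0 <= q -> q < 1 ->
  n.+1%:R * q ^+ n <= (1 - q)^-1.
Proof.
move=> q0 q1; rewrite -[leRHS]mul1r ler_pdivlMr ?subr_gt0 //.
elim: n => [|n IHn]; first by rewrite expr0; lra.
rewrite exprS -[n.+2]addn1 natrD.
have qn0 : 0 <= q ^+ n by rewrite exprn_ge0.
have qn1 : q ^+ n <= 1 by rewrite exprn_ile1 // ltW.
have : q * (n.+1%:R * q ^+ n * (1 - q)) <= q * 1 by rewrite ler_wpM2l.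
have : q * q ^+ n * (1 - q) <= 1 - q.
  rewrite -[leRHS]mul1r; apply: ler_wpM2r; first by lra.
  by rewrite mulr_ile1 // ltW.
lra.
Qed.

Lemma tame_diffs u : tame u -> tame (pseries_diffs u).
Proof.
move=> tu r r0 rlt; pose s := (r + 1 / 2) / 2.
have s0 : 0 < s by rewrite /s; lra.
have [C uC] := tu s (ltW s0) ltac:(rewrite /s; lra).
have C0 : 0 <= C by rewrite (le_trans _ (uC 0%N)) // expr0 mulr1.
have q0 : 0 <= r / s by rewrite divr_ge0 // ltW.
have q1 : r / s < 1 by rewrite ltr_pdivrMr // mul1r /s; lra.
exists ((1 - r / s)^-1 * (C / s)) => n.
have -> : `|pseries_diffs u n| * r ^+ n =
    (n.+1%:R * (r / s) ^+ n) * (`|u n.+1| * s ^+ n.+1 / s).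
  rewrite /pseries_diffs normrM normr_nat exprMn exprVn exprSr.
  by field; rewrite gt_eqF //= expf_neq0 // gt_eqF.
rewrite ler_pM ?mulr_ge0 ?exprn_ge0 ?invr_ge0 ?(ltW s0) //.
  exact: geometric_bound.
by rewrite ler_wpM2r ?invr_ge0 ?(ltW s0).
Qed.

Lemma tame_le u v : tame v -> (forall n, `|u n| <= `|v n|) -> tame u.
Proof.
move=> tv uv r r0 rlt; have [C vC] := tv r r0 rlt; exists C => n.
by rewrite (le_trans _ (vC n)) // ler_wpM2r ?exprn_ge0.
Qed.

Lemma tameZ k u : tame u -> tame (fun n => k * u n).
Proof.
move=> tu r r0 rlt; have [C uC] := tu r r0 rlt; exists (`|k| * C) => n.
by rewrite normrM -mulrA ler_wpM2l.
Qed.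

Lemma tame_is_derive u (x : R) : tame u -> `|x| < 1 / 2 ->
  is_derive x 1 (fun x => limn (pseries u x)) (limn (pseries (pseries_diffs u) x)).
Proof.
move=> tu xlt; pose K : R := (`|x| + 1 / 2) / 2.
have K0 : 0 <= K by rewrite /K; have := normr_ge0 x; lra.
have Klt : `|K| < 1 / 2 by rewrite ger0_norm // /K; lra.
apply: (@pseries_snd_diffs _ u K).
- exact: tame_cvg.
- by apply: tame_cvg => //; exact: tame_diffs.
- by apply: tame_cvg => //; do 2 apply: tame_diffs.
- by rewrite (ger0_norm K0) /K; lra.
Qed.

End PowerSeries.

(** * Generating functions of random trees *)

Lemma size_grow t : size (grow t) = nleaves t.
Proof.
elim: t => //= a IHa b IHb c IHc.
by rewrite !size_cat !size_map IHa IHb IHc addnA.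
Qed.

Lemma grow_nleaves t s : s \in grow t -> nleaves s = (nleaves t).+2.
Proof.
elim: t s => [|a IHa b IHb c IHc] s; first by rewrite inE => /eqP ->.
by rewrite /= !mem_cat => /or3P[] /mapP[d /[dup] din] => [/IHa|/IHb|/IHc] dE ->;
  rewrite /= dE; lia.
Qed.

Section TreeSeries.
Variable R : realType.
Implicit Types F H : tree -> R.

(** There are n! [coef F Leaf n] = sum of [F] over all histories of [n]
insertions, so [coef F t] is the sequence of coefficients of an exponential
generating function. The interest of this normalization is that inside a node
the three children evolve independently, which for exponential generating
functions means a product. *)
Definition grow_sum F t := \sum_(s <- grow t) F s.

Definition coef F t n := iter n grow_sum F t / n`!%:R.

(** The derivatives of the generating functions of such products are themselves
products ([dgf_lift]); moments of [cap] are bounded by sums of them. *)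
Definition lift F1 F2 F3 t :=
  if t is Node a b c then F1 a * F2 b * F3 c else 0.

Lemma iter_grow_sumD F H n t : iter n grow_sum (fun s => F s + H s) t =
  iter n grow_sum F t + iter n grow_sum H t.
Proof.
elim: n t => //= n IHn t; rewrite /grow_sum -big_split.
by apply: eq_bigr => s _; exact: IHn.
Qed.

Lemma iter_grow_sumZ k F n t :
  iter n grow_sum (fun s => k * F s) t = k * iter n grow_sum F t.
Proof.
elim: n t => //= n IHn t; rewrite /grow_sum mulr_sumr.
by apply: eq_bigr => s _; exact: IHn.
Qed.

Lemma iter_grow_sum_le F H n t :
  (forall s, nleaves s = (nleaves t + n.*2)%N -> F s <= H s) ->
  iter n grow_sum F t <= iter n grow_sum H t.
Proof.
elim: n t => [|n IHn] t FH /=; first by apply: FH; rewrite addn0.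
rewrite /grow_sum !(big_seq _ _ (grow t)); apply: ler_sum => s /grow_nleaves st.
by apply: IHn => s' s'E; apply: FH; rewrite s'E st doubleS !addnS !addSn.
Qed.

Lemma iter_grow_sum_node_le F H n a b c :
  (forall a b c, F (Node a b c) <= H (Node a b c)) ->
  iter n grow_sum F (Node a b c) <= iter n grow_sum H (Node a b c).
Proof.
move=> FH; elim: n a b c => [|n IHn] a b c /=; first exact: FH.
rewrite /grow_sum !big_cat !big_map /=.
by do ![apply: lerD|apply: ler_sum => ? _]; exact: IHn.
Qed.

Lemma fact_gt0R n : 0 < n`!%:R :> R.
Proof. by rewrite ltr0n fact_gt0. Qed.

Lemma coefD F H t n : coef (fun s => F s + H s) t n = coef F t n + coef H t n.
Proof. by rewrite /coef iter_grow_sumD mulrDl. Qed.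

Lemma coefZ k F t n : coef (fun s => k * F s) t n = k * coef F t n.
Proof. by rewrite /coef iter_grow_sumZ mulrA. Qed.

Lemma coef_le F H t n :
  (forall s, nleaves s = (nleaves t + n.*2)%N -> F s <= H s) ->
  coef F t n <= coef H t n.
Proof.
by move=> FH; rewrite ler_wpM2r ?invr_ge0 ?(ltW (fact_gt0R n)) // iter_grow_sum_le.
Qed.

Lemma coef_ge0 F t n : (forall s, 0 <= F s) -> 0 <= coef F t n.
Proof.
move=> F0; have : coef (fun s => 0 * F s) t n <= coef F t n.
  by apply: coef_le => s _; rewrite mul0r.
by rewrite coefZ mul0r.
Qed.

Lemma coef_node_le F H n a b c :
  (forall a b c, F (Node a b c) <= H (Node a b c)) ->
  coef F (Node a b c) n <= coef H (Node a b c) n.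
Proof.
move=> FH; rewrite ler_wpM2r ?invr_ge0 ?(ltW (fact_gt0R n)) //.
exact: iter_grow_sum_node_le.
Qed.

Lemma diffs_coef F t : pseries_diffs (coef F t) = coef (grow_sum F) t.
Proof.
apply/funext => n; rewrite /pseries_diffs /coef -iterSr factS natrM invfM.
by rewrite mulrCA mulVKf ?pnatr_eq0.
Qed.

Lemma diffs_coef_leaf F :
  pseries_diffs (coef F Leaf) = coef F (Node Leaf Leaf Leaf).
Proof.
rewrite diffs_coef; apply/funext => n.
by rewrite /coef -iterSr /= /grow_sum big_seq1.
Qed.

Lemma cauchy_prodDl (u u' v : R ^nat) n :
  cauchy_prod (fun i => u i + u' i) v n = cauchy_prod u v n + cauchy_prod u' v n.
Proof.
by rewrite /cauchy_prod -big_split; apply: eq_bigr => i _; rewrite mulrDl.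
Qed.

(** Independence of the three subtrees. Inserting into a node means inserting
into exactly one child, so [grow_sum] acts on products as a derivation, and this
is the Leibniz rule for its iterates. *)
Lemma coef_lift F1 F2 F3 a b c n : coef (lift F1 F2 F3) (Node a b c) n =
  cauchy_prod (cauchy_prod (coef F1 a) (coef F2 b)) (coef F3 c) n.
Proof.
elim: n F1 F2 F3 => [|n IHn] F1 F2 F3.
  by rewrite /cauchy_prod /coef !big_ord1 /= fact0 !divr1.
have n0 : (n.+1%:R : R) != 0 by rewrite pnatr_eq0.
apply: (mulfI n0).
rewrite -[LHS]/(pseries_diffs _ n) -[RHS]/(pseries_diffs _ n).
rewrite diffs_coef pseries_diffs_cauchy_prod.
have -> : pseries_diffs (cauchy_prod (coef F1 a) (coef F2 b)) =
    (fun i => cauchy_prod (coef (grow_sum F1) a) (coef F2 b) i +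
              cauchy_prod (coef F1 a) (coef (grow_sum F2) b) i).
  by apply/funext => i; rewrite pseries_diffs_cauchy_prod !diffs_coef.
rewrite diffs_coef cauchy_prodDl -!IHn -!coefD.
apply/eqP; rewrite eq_le.
by apply/andP; split; apply: coef_node_le => a1 b1 c1;
  rewrite /grow_sum /= !big_cat !big_map /= -!mulr_suml -!mulr_sumr -addrA.
Qed.

(** Quadratic growth suffices for convergence on [0, 1/2), and it covers the
first two moments of the capacity. *)
Definition moderate F := exists C, forall t, `|F t| <= C * (nleaves t)%:R ^+ 2.

Lemma coef1_rec n :
  n.+1%:R * coef (fun=> 1) Leaf n.+1 = n.*2.+1%:R * coef (fun=> 1) Leaf n.
Proof.
rewrite -[LHS]/(pseries_diffs (coef _ _) n) diffs_coef -coefZ.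
have E s : nleaves s = (nleaves Leaf + n.*2)%N ->
    grow_sum (fun=> 1) s = n.*2.+1%:R * 1.
  move=> sE; rewrite mulr1 /grow_sum big_const_seq count_predT iter_addr_0.
  by rewrite size_grow sE.
by apply/eqP; rewrite eq_le !coef_le // => s /E ->.
Qed.

Lemma coef1_ge0 n : 0 <= coef (fun=> 1) Leaf n.
Proof. by apply: coef_ge0. Qed.

Lemma coef1_le n : coef (fun=> 1) Leaf n <= 2 ^+ n.
Proof.
elim: n => [|n IHn]; first by rewrite /coef /= fact0 divr1.
have n0 : (0 : R) < n.+1%:R by rewrite ltr0n.
rewrite -(ler_pM2l n0) coef1_rec exprS.
apply: (@le_trans _ _ (n.+1%:R * 2 * coef (fun=> 1) Leaf n)).
  by rewrite ler_wpM2r ?coef1_ge0 // -natrM ler_nat; lia.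
by rewrite [leRHS]mulrA ler_wpM2l // mulr_ge0.
Qed.

Lemma tame_coef1 : tame (coef (fun=> 1) Leaf).
Proof.
move=> r r0 rlt; exists 1 => n.
rewrite ger0_norm ?coef1_ge0 // (le_trans (y := (2 * r) ^+ n)) //.
  by rewrite exprMn ler_wpM2r ?exprn_ge0 // coef1_le.
by rewrite exprn_ile1; lra.
Qed.

(** Iterating [grow_sum] twice on the constant 1 gives l (l + 2), with l the
number of leaves. So quadratic growth costs two termwise derivatives of the
series of the constant 1, and these do not change the radius of convergence. *)
Lemma moderate_tame F : moderate F -> tame (coef F Leaf).
Proof.
move=> [C FC].
have C0 : 0 <= C by have := le_trans (normr_ge0 _) (FC Leaf); rewrite expr1n mulr1.
pose W := grow_sum (grow_sum (fun=> 1)).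
have WE t : (nleaves t)%:R ^+ 2 <= W t.
  rewrite /W /grow_sum.
  have -> : \sum_(s <- grow t) \sum_(s' <- grow s) (1 : R) =
      \sum_(s <- grow t) (nleaves t).+2%:R.
    rewrite !(big_seq _ _ (grow t)); apply: eq_bigr => s /grow_nleaves <-.
    by rewrite big_const_seq count_predT iter_addr_0 size_grow.
  rewrite big_const_seq count_predT iter_addr_0 size_grow -[leRHS]mulr_natl expr2.
  by rewrite -!natrM ler_nat leq_mul2l leqW ?orbT.
have W0 t : 0 <= W t by rewrite (le_trans _ (WE t)) ?exprn_ge0.
have tW : tame (coef W Leaf).
  by rewrite /W -!diffs_coef; do 2 apply: tame_diffs; exact: tame_coef1.
apply: (tame_le (tameZ C tW)) => n.
have CW0 : 0 <= C * coef W Leaf n by apply: mulr_ge0 => //; exact: coef_ge0.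
rewrite (ger0_norm CW0) ler_norml -mulNr -!coefZ.
have FW t : `|F t| <= C * W t by rewrite (le_trans (FC t)) // ler_wpM2l.
by apply/andP; split; apply: coef_le => s _; have := FW s; rewrite ler_norml;
  case/andP; rewrite ?mulNr.
Qed.

(** [gf F x / gf 1 x] is the mean of [F] for the random tree observed at a random
time: a Yule process in which every leaf splits at rate one, at the time whose
exponential is [gf 1 x]. [dgf F] is the derivative of [gf F]; its coefficients
are those of [F] started from a single node, whence [dgf_lift]. *)
Definition gf F x := limn (pseries (coef F Leaf) x).
Definition dgf F x := limn (pseries (coef F (Node Leaf Leaf Leaf)) x).

Lemma gf_cvg F x : moderate F -> `|x| < 1 / 2 -> cvgn (pseries (coef F Leaf) x).
Proof. by move=> mF; apply: tame_cvg; exact: moderate_tame. Qed.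

Lemma dgf_cvg F x : moderate F -> `|x| < 1 / 2 ->
  cvgn (pseries (coef F (Node Leaf Leaf Leaf)) x).
Proof.
move=> mF; apply: tame_cvg; rewrite -diffs_coef_leaf; apply: tame_diffs.
exact: moderate_tame.
Qed.

Lemma gf_is_derive F (x : R) : moderate F -> `|x| < 1 / 2 ->
  is_derive x 1 (gf F) (dgf F x).
Proof.
move=> mF xlt; rewrite /dgf -diffs_coef_leaf.
by apply: tame_is_derive => //; exact: moderate_tame.
Qed.

Lemma gf0 F : gf F 0 = F Leaf.
Proof.
rewrite /gf; apply/cvg_lim => //.
apply: cvg_near_cst; exists 1%N => // -[//|n] _ /=.
rewrite /pseries /series /= big_nat_recl // expr0 mulr1.
rewrite big1 ?addr0 => [|i _]; first by rewrite /coef /= fact0 divr1.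
by rewrite exprS mul0r mulr0.
Qed.

Section AtPoint.
Variable x : R.
Hypotheses (x0 : 0 <= x) (xlt : x < 1 / 2).

Let xlt' : `|x| < 1 / 2. Proof. by rewrite ger0_norm. Qed.

Lemma pseriesD (u v : R ^nat) : cvgn (pseries u x) -> cvgn (pseries v x) ->
  limn (pseries (fun n => u n + v n) x) =
  limn (pseries u x) + limn (pseries v x).
Proof.
move=> cu cv; rewrite /pseries -lim_seriesD //; congr (limn (series _)).
by apply/funext => n; rewrite /= mulrDl.
Qed.

Lemma pseriesZ k (u : R ^nat) : cvgn (pseries u x) ->
  limn (pseries (fun n => k * u n) x) = k * limn (pseries u x).
Proof.
move=> cu; rewrite /pseries -[RHS]/(k *: _) -lim_seriesZ //.
congr (limn (series _)).
by apply/funext => n; rewrite /= -mulrA.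
Qed.

Lemma pseries_le (u v : R ^nat) : cvgn (pseries u x) -> cvgn (pseries v x) ->
  (forall n, u n <= v n) -> limn (pseries u x) <= limn (pseries v x).
Proof.
by move=> cu cv uv; apply: lim_series_le => // n; rewrite ler_wpM2r ?exprn_ge0.
Qed.

Lemma gfD F H : moderate F -> moderate H ->
  gf (fun t => F t + H t) x = gf F x + gf H x.
Proof.
move=> mF mH; rewrite -pseriesD; try exact: gf_cvg.
by congr (limn (pseries _ _)); apply/funext => n; rewrite coefD.
Qed.

Lemma gfZ k F : moderate F -> gf (fun t => k * F t) x = k * gf F x.
Proof.
move=> mF; rewrite -pseriesZ; try exact: gf_cvg.
by congr (limn (pseries _ _)); apply/funext => n; rewrite coefZ.
Qed.

Lemma gf_le F H : moderate F -> moderate H -> (forall t, F t <= H t) ->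
  gf F x <= gf H x.
Proof.
by move=> mF mH FH; apply: pseries_le => [||n]; [exact: gf_cvg..|exact: coef_le].
Qed.

Lemma dgfD F H : moderate F -> moderate H ->
  dgf (fun t => F t + H t) x = dgf F x + dgf H x.
Proof.
move=> mF mH; rewrite -pseriesD; try exact: dgf_cvg.
by congr (limn (pseries _ _)); apply/funext => n; rewrite coefD.
Qed.

Lemma dgfZ k F : moderate F -> dgf (fun t => k * F t) x = k * dgf F x.
Proof.
move=> mF; rewrite -pseriesZ; try exact: dgf_cvg.
by congr (limn (pseries _ _)); apply/funext => n; rewrite coefZ.
Qed.

Lemma dgf_le F H : moderate F -> moderate H ->
  (forall a b c, F (Node a b c) <= H (Node a b c)) -> dgf F x <= dgf H x.
Proof.
by move=> mF mH FH; apply: pseries_le => [||n];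
  [exact: dgf_cvg..|exact: coef_node_le].
Qed.

Lemma dgf_lift F1 F2 F3 : moderate F1 -> moderate F2 -> moderate F3 ->
  (forall t, 0 <= F1 t) -> (forall t, 0 <= F2 t) -> (forall t, 0 <= F3 t) ->
  dgf (lift F1 F2 F3) x = gf F1 x * gf F2 x * gf F3 x.
Proof.
move=> m1 m2 m3 p1 p2 p3.
have c0 F : (forall t, 0 <= F t) -> forall n, 0 <= coef F Leaf n.
  by move=> F0 n; exact: coef_ge0.
have [c12 l12] := pseries_cauchy_prod x0 (c0 _ p1) (c0 _ p2)
  (gf_cvg m1 xlt') (gf_cvg m2 xlt').
have [_ l123] := pseries_cauchy_prod x0
  (cauchy_prod_ge0 (c0 _ p1) (c0 _ p2)) (c0 _ p3) c12 (gf_cvg m3 xlt').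
rewrite -l12 -l123 /dgf; congr (limn (pseries _ _)).
by apply/funext => n; rewrite coef_lift.
Qed.

Lemma gf_ge_sum F m n : moderate F -> (forall t, 0 <= F t) ->
  \sum_(m <= i < n) coef F Leaf i * x ^+ i <= gf F x.
Proof.
move=> mF F0; have t0 i : 0 <= coef F Leaf i * x ^+ i.
  by rewrite mulr_ge0 ?exprn_ge0 // coef_ge0.
apply: (le_trans (y := pseries (coef F Leaf) x n)); last first.
  apply: nondecreasing_cvgn_le; last exact: gf_cvg.
  by apply: nondecreasing_series => i _ _; exact: t0.
have [mn|nm] := leqP m n; last first.
  by rewrite big_geq ?(ltnW nm) //; apply: sumr_ge0 => i _; exact: t0.
rewrite /pseries /series /= (big_cat_nat (leq0n m) mn) /=.
by rewrite lerDr; apply: sumr_ge0 => i _; exact: t0.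
Qed.

End AtPoint.
End TreeSeries.

(** * Differential inequalities for the moments of the capacity *)

Section Flow.
Variable R : realType.
Implicit Types F H X : tree -> R.

(** Nonnegative and at most the [k]-th power of the number of leaves; exponents
add up in products over subtrees. *)
Definition graded k F := forall t, 0 <= F t <= (nleaves t)%:R ^+ k.

Lemma nleaves_ge1 t : 1 <= (nleaves t)%:R :> R.
Proof. by rewrite ler1n; elim: t => //= a Ha b Hb c Hc; lia. Qed.

Lemma graded_ge0 k F t : graded k F -> 0 <= F t.
Proof. by move=> /(_ t) /andP[]. Qed.

Lemma graded_moderate k F : (k <= 2)%N -> graded k F -> moderate F.
Proof.
move=> k2 gF; exists 1 => t; have /andP[F0 Fl] := gF t.
by rewrite ger0_norm // mul1r (le_trans Fl) // ler_weXn2l // nleaves_ge1.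
Qed.

Lemma graded_one : graded 0 (fun=> 1).
Proof. by move=> t; rewrite expr0 ler01 lexx. Qed.

Lemma graded_cap : graded 1 cap.
Proof.
by move=> t; rewrite expr1 cap_le_nleaves (le_trans ler01 (cap_ge1 R t)).
Qed.

Lemma graded_min_child : graded 1 min_child.
Proof.
move=> t; rewrite expr1 (le_trans ler01 (min_child_ge1 R t)) /=.
exact: le_trans (min_child_le_cap R t) (cap_le_nleaves R t).
Qed.

Lemma graded_sqr X : graded 1 X -> graded 2 (fun t => X t ^+ 2).
Proof.
move=> gX t; have := gX t; rewrite expr1 => /andP[X0 Xl].
by rewrite exprn_ge0 // lerXn2r // nnegrE // (le_trans X0 Xl).
Qed.

Lemma graded_ind X (th : R) : graded 0 (fun t => (th <= X t)%R%:R).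
Proof. by move=> t; rewrite expr0 ler0n lern1 leq_b1. Qed.

Lemma graded_lift k1 k2 k3 F1 F2 F3 : graded k1 F1 -> graded k2 F2 ->
  graded k3 F3 -> graded (k1 + k2 + k3) (lift F1 F2 F3).
Proof.
move=> g1 g2 g3 [|a b c] /=; first by rewrite lexx expr1n ler01.
have /andP[p1 l1] := g1 a; have /andP[p2 l2] := g2 b; have /andP[p3 l3] := g3 c.
rewrite !mulr_ge0 //= !exprD.
have le_pow (u : tree) k F : (nleaves u <= nleaves a + nleaves b + nleaves c)%N ->
    F u <= (nleaves u)%:R ^+ k ->
    F u <= (nleaves a + nleaves b + nleaves c)%:R ^+ k :> R.
  by move=> h h'; rewrite (le_trans h') // lerXn2r ?nnegrE ?ler0n // ler_nat.
by rewrite !ler_pM ?mulr_ge0 //; apply: le_pow => //; lia.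
Qed.

Definition lift_min X t : R :=
  if t is Node a b c then Num.min (X a) (Num.min (X b) (X c)) else 0.

Lemma graded_lift_min X : graded 1 X -> graded 1 (lift_min X).
Proof.
move=> gX [|a b c] /=; first by rewrite expr1 lexx ler01.
have [m [-> ma _ _ mE]] := min3P (X a) (X b) (X c).
have /andP[Xa la] := gX a; have /andP[Xb _] := gX b; have /andP[Xc _] := gX c.
apply/andP; split; first by case: mE => ->.
by rewrite (le_trans ma) // (le_trans la) // !expr1 ler_nat; lia.
Qed.

Lemma moderateD F H : moderate F -> moderate H -> moderate (fun t => F t + H t).
Proof.
move=> [C FC] [D HD]; exists (C + D) => t.
by rewrite (le_trans (ler_normD _ _)) // mulrDl lerD.
Qed.

Lemma moderateZ k F : moderate F -> moderate (fun t => k * F t).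
Proof.
by move=> [C FC]; exists (`|k| * C) => t; rewrite normrM -mulrA ler_wpM2l.
Qed.

Let one : tree -> R := fun=> 1.

Let mod1 : moderate one. Proof. exact: graded_moderate graded_one. Qed.
Let modc : moderate (cap : tree -> R).
Proof. exact: graded_moderate graded_cap. Qed.
Let modl : moderate (min_child : tree -> R).
Proof. exact: graded_moderate graded_min_child. Qed.

Section AtPoint.
Variable x : R.
Hypotheses (x0 : 0 <= x) (xlt : x < 1 / 2).

Let xlt' : `|x| < 1 / 2. Proof. by rewrite ger0_norm. Qed.

Lemma gf1_ge1 : 1 <= gf one x.
Proof.
have := @gf_ge_sum R x x0 xlt one 0 1 mod1 (fun=> ler01).
by rewrite big_nat1 expr0 mulr1 /coef /= fact0 divr1.
Qed.

Lemma gf1_gt0 : 0 < gf one x. Proof. exact: lt_le_trans ltr01 gf1_ge1. Qed.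

Lemma gf_cap_ge1 : 1 <= gf cap x.
Proof.
by apply: le_trans gf1_ge1 _; apply: gf_le => // t; exact: cap_ge1.
Qed.

Lemma gf_cap_gt0 : 0 < gf cap x. Proof. exact: lt_le_trans ltr01 gf_cap_ge1. Qed.

Lemma dgf1 : dgf one x = gf one x ^+ 3.
Proof.
have -> : gf one x ^+ 3 = gf one x * gf one x * gf one x by ring.
have g := graded_lift graded_one graded_one graded_one.
rewrite -dgf_lift //; have m := graded_moderate (ltac:(by []) : (0 <= 2)%N) g.
by apply/eqP; rewrite eq_le; apply/andP; split; apply: dgf_le => // a b c;
  rewrite /= !mulr1.
Qed.

Definition lift_sum X t : R :=
  lift X one one t + lift one X one t + lift one one X t.

Lemma moderate_lift_sum X k : (k <= 2)%N -> graded k X -> moderate (lift_sum X).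
Proof.
move=> k2 gX; do ![apply: moderateD]; (apply: graded_moderate;
  [|by apply: graded_lift; (exact: gX || exact: graded_one)]); rewrite ?addn0; lia.
Qed.

Lemma dgf_lift_sum X k : (k <= 2)%N -> graded k X ->
  dgf (lift_sum X) x = 3 * gf X x * gf one x ^+ 2.
Proof.
move=> k2 gX; have mX := graded_moderate k2 gX.
have X0 t := graded_ge0 t gX.
have ml F1 F2 F3 i j l : graded i F1 -> graded j F2 -> graded l F3 ->
   (i + j + l <= 2)%N -> moderate (lift F1 F2 F3).
  by move=> g1 g2 g3 le2; apply: graded_moderate le2 _; exact: graded_lift.
have m1 := ml _ _ _ _ _ _ gX graded_one graded_one ltac:(lia).
have m2 := ml _ _ _ _ _ _ graded_one gX graded_one ltac:(lia).
have m3 := ml _ _ _ _ _ _ graded_one graded_one gX ltac:(lia).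
rewrite !dgfD //; last exact: moderateD.
by rewrite !dgf_lift //; ring.
Qed.

Lemma dgf_cap : dgf cap x = 3 * gf cap x * gf one x ^+ 2
  - dgf (lift_min min_child) x / 4.
Proof.
have mm : moderate (lift_min min_child : tree -> R).
  by apply: (@graded_moderate 1) => //; exact/graded_lift_min/graded_min_child.
have ms : moderate (lift_sum cap).
  by apply: (@moderate_lift_sum _ 1) => //; exact: graded_cap.
rewrite -(@dgf_lift_sum cap 1) //; last exact: graded_cap.
have -> : - (dgf (lift_min min_child) x / 4) =
    dgf (fun t => - 4^-1 * lift_min min_child t) x.
  by rewrite dgfZ // mulNr mulrC.
rewrite -dgfD //; last exact: moderateZ.
have md : moderate (fun t => lift_sum cap t + - 4^-1 * lift_min min_child t).
  by apply: moderateD => //; exact: moderateZ.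
by apply/eqP; rewrite eq_le; apply/andP; split; apply: dgf_le => // a b c;
  rewrite cap_node /lift_sum /= /one !mulr1 !mul1r; lra.
Qed.

(** The minimum of three numbers is at most their average, so the discount costs
at most a twelfth of the total. *)
Lemma dgf_cap_ge : 11 / 4 * gf cap x * gf one x ^+ 2 <= dgf cap x.
Proof.
rewrite dgf_cap.
suff : dgf (lift_min min_child) x <= gf cap x * gf one x ^+ 2 by lra.
have -> : gf cap x * gf one x ^+ 2 = dgf (fun t => 3^-1 * lift_sum cap t) x.
  have ms := moderate_lift_sum (ltac:(by []) : (1 <= 2)%N) graded_cap.
  rewrite dgfZ // (@dgf_lift_sum cap 1) //; last exact: graded_cap.
  by rewrite !mulrA mulVf // mul1r.
apply: dgf_le => //.
- by apply: (@graded_moderate 1) => //; exact/graded_lift_min/graded_min_child.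
- by apply: moderateZ; apply: (@moderate_lift_sum _ 1) => //; exact: graded_cap.
move=> a b c; rewrite /lift_sum /= /one !mulr1 !mul1r.
have [m [-> ma mb mc _]] := min3P (min_child a : R) (min_child b) (min_child c).
have := min_child_le_cap R a; have := min_child_le_cap R b.
have := min_child_le_cap R c.
lra.
Qed.

Lemma dgf_cap_le : dgf cap x <= 3 * gf cap x * gf one x ^+ 2.
Proof.
rewrite -(@dgf_lift_sum cap 1) //; last exact: graded_cap.
apply: dgf_le => //.
  by apply: (@moderate_lift_sum _ 1) => //; exact: graded_cap.
move=> a b c; rewrite cap_node /lift_sum /= /one !mulr1 !mul1r.
have [m [-> _ _ _ mE]] := min3P (min_child a : R) (min_child b) (min_child c).
have := min_child_ge1 R a; have := min_child_ge1 R b; have := min_child_ge1 R c.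
by case: mE => ->; lra.
Qed.

(** Cross terms are products of means by independence, whence the square of the
mean on the right. *)
Lemma dgf_cap2_le : dgf (fun t => cap t ^+ 2) x <=
  3 * gf (fun t => cap t ^+ 2) x * gf one x ^+ 2 + 6 * gf cap x ^+ 2 * gf one x.
Proof.
have g2 := graded_sqr graded_cap; have m2 := graded_moderate (leqnn 2) g2.
have gc := graded_cap; have g1 := graded_one.
have ml F1 F2 F3 k1 k2 k3 : graded k1 F1 -> graded k2 F2 -> graded k3 F3 ->
   (k1 + k2 + k3 <= 2)%N -> moderate (lift F1 F2 F3).
  by move=> h1 h2 h3 le2; apply: graded_moderate le2 _; exact: graded_lift.
have mA := ml _ _ _ _ _ _ gc gc g1 ltac:(lia).
have mB := ml _ _ _ _ _ _ gc g1 gc ltac:(lia).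
have mC := ml _ _ _ _ _ _ g1 gc gc ltac:(lia).
have mS := moderate_lift_sum (leqnn 2) g2.
have c0 t : 0 <= cap t :> R := graded_ge0 t gc.
rewrite -(@dgf_lift_sum _ 2) //.
have -> : 6 * gf cap x ^+ 2 * gf one x = dgf (fun t => 2 *
    (lift cap cap one t + lift cap one cap t + lift one cap cap t)) x.
  rewrite dgfZ ?dgfD //; do ?[apply: moderateD => //].
  by rewrite !dgf_lift //; ring.
have mD : moderate (fun t => 2 *
    (lift cap cap one t + lift cap one cap t + lift one cap cap t)).
  by apply: moderateZ; do ![apply: moderateD => //].
rewrite -dgfD //; apply: dgf_le => //; first exact: moderateD.
move=> a b c; rewrite cap_node /lift_sum /= /one !mulr1 !mul1r.
have [m [-> _ _ _ mE]] := min3P (min_child a : R) (min_child b) (min_child c).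
have [ca la lca] := cap_min_child R a; have [cb lb lcb] := cap_min_child R b.
have [cc lc lcc] := cap_min_child R c.
have m0 : 0 <= m by case: mE => ->; lra.
have mle : m <= cap a + cap b + cap c by case: mE => ->; lra.
apply: (@le_trans _ _ ((cap a + cap b + cap c) ^+ 2)); last first.
  by rewrite le_eqVlt; apply/orP; left; apply/eqP; ring.
by rewrite lerXn2r // ?nnegrE; lra.
Qed.

(** The minimum of three independent copies of [X] has a mean comparable to that
of [cap], provided that the mean of [X] is and that the second moment is
comparable to the square of the mean. By the second moment method, each copy
exceeds a quarter of its mean with probability bounded below, and all three do so
with the cube of that probability. *)
Lemma min_lower_bound X (ka : R) : graded 1 X -> 0 < ka ->
  ka * gf cap x <= gf X x ->
  gf (fun t => X t ^+ 2) x * gf one x <= 4 * gf cap x ^+ 2 ->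
  ka ^+ 7 / 2048 * gf cap x * gf one x ^+ 2 <= dgf (lift_min X) x.
Proof.
move=> gX ka0 kX sX; have X0 t := graded_ge0 t gX.
have mX := graded_moderate (ltac:(by []) : (1 <= 2)%N) gX.
have mX2 := graded_moderate (leqnn 2) (graded_sqr gX).
set Y := gf one x in sX *; set m := gf cap x in kX sX *; set g := gf X x in kX.
have Y0 : 0 < Y := gf1_gt0; have m0 : 0 < m := gf_cap_gt0.
have g0 : 0 < g by rewrite (lt_le_trans _ kX) ?mulr_gt0.
pose th := g / (4 * Y); have th0 : 0 < th by rewrite divr_gt0 ?mulr_gt0.
pose ep := g * Y / (16 * m ^+ 2).
have ep0 : 0 < ep by rewrite divr_gt0 ?mulr_gt0 ?exprn_gt0.
pose I t : R := (th <= X t)%R%:R.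
have mI := graded_moderate (leq0n 2) (graded_ind X th).
have I0 t : 0 <= I t by rewrite ler0n.
(* With the choice of ep, the elementary bound X <= th + ep X^2 if X < th, and
   X <= ep X^2 + 1 / (4 ep) otherwise, loses at most half of the mean of X. *)
have PX : g <= th * Y + ep * gf (fun t => X t ^+ 2) x + (4 * ep)^-1 * gf I x.
  rewrite -!gfZ //; have mT := moderateZ th mod1.
  have mS := moderateZ ep mX2; have mJ := moderateZ (4 * ep)^-1 mI.
  rewrite -!gfD //; last exact: moderateD.
  apply: gf_le => //; first by do ![apply: moderateD => //].
  move=> t; rewrite /one mulr1 /I; case: (leP th (X t)) => [_|Xt]; last first.
    rewrite /= ?mulr0n mulr0 addr0 (le_trans (ltW Xt)) // lerDl.
    by rewrite mulr_ge0 ?(ltW ep0) // exprn_ge0.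
  rewrite /= ?mulr1n mulr1 -subr_ge0.
  have -> : th + ep * X t ^+ 2 + (4 * ep)^-1 - X t =
      th + (2 * ep * X t - 1) ^+ 2 / (4 * ep) by field; rewrite gt_eqF.
  by rewrite addr_ge0 ?(ltW th0) // divr_ge0 ?sqr_ge0 // mulr_ge0 // ltW.
have thY : th * Y = g / 4 by rewrite /th; field; rewrite gt_eqF.
have epS : ep * gf (fun t => X t ^+ 2) x <= g / 4.
  have -> : g / 4 = g / (16 * m ^+ 2) * (4 * m ^+ 2).
    by field; rewrite gt_eqF.
  have -> : ep * gf (fun t => X t ^+ 2) x =
      g / (16 * m ^+ 2) * (gf (fun t => X t ^+ 2) x * Y) by rewrite /ep; ring.
  by rewrite ler_wpM2l // divr_ge0 ?(ltW g0) // mulr_ge0 // exprn_ge0 // ltW.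
have {PX epS thY} PI : ka ^+ 2 * Y / 8 <= gf I x.
  have : g / 2 <= (4 * ep)^-1 * gf I x by lra.
  have ep4 : 0 < 4 * ep by apply: mulr_gt0.
  rewrite [X in _ <= X -> _]mulrC (ler_pdivlMr _ _ ep4) => h.
  apply: le_trans h.
  have -> : g / 2 * (4 * ep) = g ^+ 2 * Y / (8 * m ^+ 2).
    by rewrite /ep; field; rewrite gt_eqF.
  rewrite ler_pdivlMr ?mulr_gt0 ?exprn_gt0 //.
  have -> : ka ^+ 2 * Y / 8 * (8 * m ^+ 2) = (ka * m) ^+ 2 * Y by field.
  by rewrite ler_wpM2r ?(ltW Y0) // lerXn2r // nnegrE ?mulr_ge0 // ltW.
have gI := graded_ind X th.
have mlI := graded_moderate (leq0n 2) (graded_lift gI gI gI).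
have : th * gf I x ^+ 3 <= dgf (lift_min X) x.
  have -> : gf I x ^+ 3 = gf I x * gf I x * gf I x by ring.
  rewrite -dgf_lift // -dgfZ //; apply: dgf_le => //.
  - exact: moderateZ.
  - by apply: (@graded_moderate 1) => //; exact: graded_lift_min.
  move=> a b c; rewrite /= /I.
  have [k [-> _ _ _ kE]] := min3P (X a) (X b) (X c).
  case: (leP th (X a)) => ha; case: (leP th (X b)) => hb;
    case: (leP th (X c)) => hc; rewrite /= ?(mulr0n, mulr1n) ?(mulr0, mul0r, mulr1);
    case: kE => -> //; exact: le_trans (X0 _).
apply: le_trans.
apply: (@le_trans _ _ (ka * m / (4 * Y) * (ka ^+ 2 * Y / 8) ^+ 3)).
  rewrite le_eqVlt; apply/orP; left; apply/eqP; field; rewrite gt_eqF //.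
apply: ler_pM.
- by rewrite divr_ge0 ?mulr_ge0 // ltW.
- by rewrite exprn_ge0 // divr_ge0 // mulr_ge0 ?exprn_ge0 // ltW.
- by rewrite /th ler_wpM2r // invr_ge0 mulr_ge0 // ltW.
- rewrite lerXn2r // nnegrE.
    by rewrite divr_ge0 // mulr_ge0 ?exprn_ge0 // ltW.
  by rewrite (le_trans _ PI) // divr_ge0 // mulr_ge0 ?exprn_ge0 // ltW.
Qed.

End AtPoint.
End Flow.

(** * Growth of the mean capacity *)

Section Growth.
Variable R : realType.

Lemma le_initial (f : R -> R) (a x : R) : 0 <= x -> x < a ->
  (forall y, 0 <= y -> y < a -> exists2 d, d <= 0 & is_derive y 1 f d) ->
  f x <= f 0.
Proof.
move=> x0 xa fdf.
have fD y : 0 <= y -> y < a -> is_derive y 1 f ('D_1 f y) /\ 'D_1 f y <= 0.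
  move=> y0 ya; have [d d0 fd] := fdf y y0 ya.
  by rewrite derive_val.
have fdx y : y \in `]0, x[%R -> is_derive y 1 f ('D_1 f y).
  rewrite in_itv /= => /andP[y0 yx].
  by case: (fD y (ltW y0) (lt_trans yx xa)).
have fc : {within `[0, x], continuous f}.
  apply: derivable_within_continuous => y; rewrite in_itv /= => /andP[y0 yx].
  by have [[]] := fD y y0 (le_lt_trans yx xa).
have [y] := MVT_segment x0 fdx fc; rewrite in_itv /= => /andP[y0 yx] e.
rewrite -subr_le0 e subr0 mulr_le0_ge0 //.
by have [] := fD y y0 (le_lt_trans yx xa).
Qed.

Lemma deriveMfun (f g : R -> R) (df dg x : R) :
  is_derive x 1 f df -> is_derive x 1 g dg ->
  is_derive x 1 (fun y => f y * g y) (df * g x + f x * dg).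
Proof.
move=> hf hg; have -> : df * g x + f x * dg = f x *: dg + g x *: df.
  by rewrite addrC [df * _]mulrC.
exact: is_deriveM.
Qed.

Let one : tree -> R := fun=> 1.
Let Y x : R := gf one x.
Let Z x : R := (Y x)^-1.
Let m x : R := gf cap x.
Let s x : R := gf (fun t => cap t ^+ 2) x.

Section Derivatives.
Variable x : R.
Hypotheses (x0 : 0 <= x) (xlt : x < 1 / 2).
Let xlt' : `|x| < 1 / 2. Proof. by rewrite ger0_norm. Qed.

Lemma Y_gt0 : 0 < Y x. Proof. exact: gf1_gt0. Qed.
Lemma m_gt0 : 0 < m x. Proof. exact: gf_cap_gt0. Qed.

Lemma Y_derive : is_derive x 1 Y (Y x ^+ 3).
Proof.
rewrite -dgf1 //; apply: gf_is_derive => //.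
exact: graded_moderate (@graded_one R).
Qed.

Lemma m_derive : is_derive x 1 m (dgf cap x).
Proof. by apply: gf_is_derive => //; exact: graded_moderate (@graded_cap R). Qed.

Lemma min_child_derive : is_derive x 1 (gf min_child) (dgf min_child x).
Proof.
by apply: gf_is_derive => //; exact: graded_moderate (@graded_min_child R).
Qed.

Lemma s_derive : is_derive x 1 s (dgf (fun t => cap t ^+ 2) x).
Proof.
by apply: gf_is_derive => //; exact: graded_moderate (graded_sqr (@graded_cap R)).
Qed.

Lemma Z_derive : is_derive x 1 Z (- Y x).
Proof.
have Y0 := Y_gt0.
have := is_deriveV (lt0r_neq0 Y0) Y_derive.
suff -> : - (Y x) ^- 2 *: Y x ^+ 3 = - Y x by [].
by rewrite -[_ *: _]/(_ * _); field; rewrite gt_eqF.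
Qed.

End Derivatives.

Lemma gf_at0 : (Y 0 = 1) * (m 0 = 1) * (s 0 = 1) * (gf min_child 0 = 1 :> R).
Proof. by rewrite /Y /m /s !gf0 /= expr1n. Qed.

Lemma derive_eq (f : R -> R) (x d d' : R) :
  is_derive x 1 f d -> d = d' -> is_derive x 1 f d'.
Proof. by move=> h <-. Qed.

Lemma deriveZfun (k : R) (f : R -> R) (x df : R) :
  is_derive x 1 f df -> is_derive x 1 (fun y => k * f y) (k * df).
Proof. by move=> h; exact: is_deriveZ. Qed.

Lemma deriveDfun (f g : R -> R) (x df dg : R) :
  is_derive x 1 f df -> is_derive x 1 g dg ->
  is_derive x 1 (fun y => f y + g y) (df + dg).
Proof. by move=> hf hg; exact: is_deriveD. Qed.

(** Since Y' = Y^3, the function 1 / Y^2 has derivative -2. *)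
Lemma Z2 (x : R) : 0 <= x -> x < 1 / 2 -> Z x * Z x = 1 - 2 * x.
Proof.
move=> x0 xlt.
have der (k y : R) : 0 <= y -> y < 1 / 2 -> exists2 d, d <= 0 &
    is_derive y 1 (fun y => k * (Z y * Z y + 2 * y)) d.
  move=> y0 ylt; exists 0 => //.
  have dZ := Z_derive y0 ylt; have Y0 := Y_gt0 y0 ylt.
  have D := deriveZfun k (deriveDfun (deriveMfun dZ dZ)
    (deriveZfun 2 (is_derive_id y 1))).
  by apply: derive_eq D _; rewrite /Z; field; rewrite gt_eqF.
have := le_initial x0 xlt (der 1).
have := le_initial x0 xlt (der (-1)).
by rewrite /Z !gf_at0 invr1; lra.
Qed.

(** The mean square of the capacity stays within a factor 4 of the square of its
mean. The first is driven by three times itself plus six squared means, while the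
squared mean grows at least like Y^(2 * 11/4); as 2 * 11/4 exceeds 3 + 1 the
quantity s / Y^3 - 4 m^2 / Y^4 is nonincreasing, and it is negative at 0. *)
Lemma second_moment (x : R) : 0 <= x -> x < 1 / 2 -> s x * Y x <= 4 * m x ^+ 2.
Proof.
move=> x0 xlt; have Y0 := Y_gt0 x0 xlt.
have der (y : R) : 0 <= y -> y < 1 / 2 -> exists2 d, d <= 0 &
  is_derive y 1 (fun y => s y * (Z y * (Z y * Z y))
    + -4 * (m y * m y * (Z y * Z y * (Z y * Z y)))) d.
  move=> y0 ylt; have dZ := Z_derive y0 ylt; have {}Y0 := Y_gt0 y0 ylt.
  have dm := m_derive y0 ylt; have ds := s_derive y0 ylt.
  have dZZ := deriveMfun dZ dZ.
  have D := deriveDfun (deriveMfun ds (deriveMfun dZ dZZ))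
    (deriveZfun (-4) (deriveMfun (deriveMfun dm dm) (deriveMfun dZZ dZZ))).
  eexists; last exact: D.
  have := dgf_cap2_le y0 ylt; have := dgf_cap_ge y0 ylt.
  rewrite -/(s y) -/(m y) -/(Y y).
  set m' := dgf cap y; set s' := dgf _ y => hm hs.
  have m0 := m_gt0 y0 ylt.
  have -> : s' * (Z y * (Z y * Z y)) + s y * (- Y y * (Z y * Z y) +
      Z y * (- Y y * Z y + Z y * - Y y)) +
    -4 * ((m' * m y + m y * m') * (Z y * Z y * (Z y * Z y)) +
      m y * m y * ((- Y y * Z y + Z y * - Y y) * (Z y * Z y) +
        Z y * Z y * (- Y y * Z y + Z y * - Y y))) =
    (s' - (3 * s y * Y y ^+ 2 + 6 * m y ^+ 2 * Y y)) * (Z y * (Z y * Z y))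
    - 8 * m y * Z y ^+ 4 * (m' - 11 / 4 * m y * Y y ^+ 2).
    by rewrite /Z; field; rewrite gt_eqF.
  have Z0 : 0 < Z y by rewrite invr_gt0.
  rewrite subr_le0 (le_trans (y := 0)) //.
    by rewrite mulr_le0_ge0 ?subr_le0 // !mulr_ge0 // ltW.
  by rewrite mulr_ge0 ?subr_ge0 // !mulr_ge0 ?exprn_ge0 // ltW.
have := le_initial x0 xlt der.
rewrite /Z !gf_at0 invr1 => h.
have {}h : s x * (Y x)^-1 ^+ 3 <= 4 * m x ^+ 2 * (Y x)^-1 ^+ 4 by lra.
have := ler_wpM2r (exprn_ge0 4 (ltW Y0)) h.
have -> : s x * (Y x)^-1 ^+ 3 * Y x ^+ 4 = s x * Y x by field; rewrite gt_eqF.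
by have -> : 4 * m x ^+ 2 * (Y x)^-1 ^+ 4 * Y x ^+ 4 = 4 * m x ^+ 2
  by field; rewrite gt_eqF.
Qed.

(** [min_child] is a minimum of three capacities, so by [min_lower_bound] its mean
grows at least at a fixed fraction of the rate of the mean capacity. *)
Lemma gf_min_child_ge : exists2 k : R, 0 < k &
  forall x : R, 0 <= x -> x < 1 / 2 -> k * m x <= gf min_child x.
Proof.
have k0 : 0 < 6144^-1 :> R by rewrite invr_gt0 ltr0n.
(* 6144 = 3 * 2048, with 2048 from [min_lower_bound] at ka = 1 and 3 from the
   upper bound on the growth rate of m. *)
exists 6144^-1; first exact: k0.
move=> x x0 xlt.
have der (y : R) : 0 <= y -> y < 1 / 2 -> exists2 d, d <= 0 &
    is_derive y 1 (fun y => 6144^-1 * m y + -1 * gf min_child y) d.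
  move=> y0 ylt; have dm := m_derive y0 ylt; have dl := min_child_derive y0 ylt.
  eexists; last exact: deriveDfun (deriveZfun _ dm) (deriveZfun (-1) dl).
  have h1 := dgf_cap_le y0 ylt.
  have ylt' : `|y| < 1 / 2 by rewrite ger0_norm.
  have h2 : dgf (lift_min cap) y <= dgf min_child y.
    apply: dgf_le => //; last exact: graded_moderate (@graded_min_child R).
    by apply: (@graded_moderate _ 1) => //; exact/graded_lift_min/graded_cap.
  have h3 : 1 ^+ 7 / 2048 * gf cap y * gf one y ^+ 2 <= dgf (lift_min cap) y.
    apply: (min_lower_bound y0 ylt (@graded_cap R) ltr01).
      by rewrite mul1r.
    exact: second_moment.
  rewrite expr1n in h3; rewrite -/one in h1; lra.
have := le_initial x0 xlt der; rewrite !gf_at0; lra.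
Qed.

(** The decisive gain: the discount is a minimum of three copies of [min_child], so
[min_lower_bound] applies a second time and removes a fixed proportion of the
growth rate 3. *)
Lemma dgf_cap_lt : exists2 k : R, 0 < k &
  forall x : R, 0 <= x -> x < 1 / 2 -> dgf cap x <= (3 - k) * m x * Y x ^+ 2.
Proof.
have [k k0 low_k] := gf_min_child_ge.
pose g := k ^+ 7 / 2048.
have g0 : 0 < g.
  by apply: divr_gt0; [exact: exprn_gt0|rewrite ltr0n].
exists (g / 4); first by apply: divr_gt0; [exact: g0|rewrite ltr0n].
move=> x x0 xlt; rewrite dgf_cap //.
have : g * gf cap x * gf one x ^+ 2 <= dgf (lift_min min_child) x.
  apply: (min_lower_bound x0 xlt (@graded_min_child R) k0); first exact: low_k.
  apply: le_trans (second_moment x0 xlt).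
  rewrite ler_wpM2r ?(ltW (Y_gt0 x0 xlt)) //; apply: gf_le => //.
  - exact: graded_moderate (graded_sqr (@graded_min_child R)).
  - exact: graded_moderate (graded_sqr (@graded_cap R)).
  move=> t; have [c1 l1 lc] := cap_min_child R t.
  by rewrite lerXn2r // nnegrE; lra.
rewrite -/one -/(Y x) -/(m x); move: (g) => h; lra.
Qed.

(** Comparison with Y^(3-k), in logarithmic form; [- ln (1 - 2 * x) / 2] is
ln Y. *)
Lemma gf_cap_growth : exists2 k : R, 0 < k &
  forall x : R, 0 <= x -> x < 1 / 2 ->
    ln (gf cap x) <= (3 - k) * (- ln (1 - 2 * x) / 2).
Proof.
have [k k0 cap_k] := dgf_cap_lt; exists k => // x x0 xlt.
have Y0 := Y_gt0 x0 xlt.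
have -> : - ln (1 - 2 * x) / 2 = ln (Y x).
  by rewrite -Z2 // lnM ?posrE ?invr_gt0 // lnV ?posrE //; field.
have der (y : R) : 0 <= y -> y < 1 / 2 -> exists2 d, d <= 0 &
    is_derive y 1 (fun y => ln (m y) + - (3 - k) * ln (Y y)) d.
  move=> y0 ylt; have dm := m_derive y0 ylt; have dY := Y_derive y0 ylt.
  have m0 := m_gt0 y0 ylt; have {}Y0 := Y_gt0 y0 ylt.
  have dlm := is_derive1_comp (is_derive1_ln m0) dm.
  have dlY := is_derive1_comp (is_derive1_ln Y0) dY.
  eexists; last exact: deriveDfun dlm (deriveZfun _ dlY).
  have -> : (m y)^-1 * dgf cap y + - (3 - k) * ((Y y)^-1 * Y y ^+ 3) =
    (m y)^-1 * (dgf cap y - (3 - k) * m y * Y y ^+ 2).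
    by field; rewrite !gt_eqF.
  by rewrite mulr_ge0_le0 ?invr_ge0 ?(ltW m0) // subr_le0 cap_k.
have := le_initial x0 xlt der; rewrite !gf_at0 ln1; rewrite -/(m x); lra.
Qed.

End Growth.

(** * The mean capacity of a tree with a given number of nodes *)

Section Average.
Variable R : realType.
Implicit Types F H : tree -> R.

Lemma tree_expect_le n F H : (forall t, F t <= H t) ->
  tree_expect n F <= tree_expect n H.
Proof.
elim: n F H => [|n IHn] F H FH /=; first exact: FH.
apply: IHn => t; rewrite ler_wpM2r ?invr_ge0 //.
by apply: ler_sum => s _; exact: FH.
Qed.

Lemma tree_expectZ n k F : tree_expect n (fun t => k * F t) = k * tree_expect n F.
Proof.
elim: n F => [//|n IHn] F /=; rewrite -IHn; congr tree_expect.
by apply/funext => t; rewrite -mulr_sumr mulrA.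
Qed.

Lemma size_grow_neq0 t : (size (grow t))%:R != 0 :> R.
Proof.
rewrite size_grow pnatr_eq0 -lt0n -(ltr0n R).
exact: lt_le_trans ltr01 (nleaves_ge1 R t).
Qed.

Lemma tree_expect_capS n : tree_expect n cap <= tree_expect n.+1 cap :> R.
Proof.
apply: tree_expect_le => t; rewrite ler_pdivlMr; last first.
  by rewrite lt_neqAle eq_sym size_grow_neq0 ler0n.
rewrite mulr_natr -iter_addr_0 -(count_predT (grow t)) -big_const_seq.
rewrite big_seq [leRHS]big_seq; apply: ler_sum => s st.
by have [] := cap_grow R st.
Qed.

Lemma tree_expect_cap_nd n k : (n <= k)%N ->
  tree_expect n cap <= tree_expect k cap :> R.
Proof.
move=> nk; rewrite -(subnK nk); elim: (k - n)%N => //= j IH.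
exact: le_trans IH (tree_expect_capS _).
Qed.

(** At step [n] every tree has 2n+1 leaves, so all histories of [n] insertions
are equally likely. *)
Lemma coef_tree_expect F n :
  coef F Leaf n = coef (fun=> 1) Leaf n * tree_expect n F.
Proof.
elim: n F => [|n IHn] F; first by rewrite /coef /= fact0 !divr1 mul1r.
have n0 : (n.+1%:R : R) != 0 by rewrite pnatr_eq0.
apply: (mulfI n0); rewrite [RHS]mulrA coef1_rec.
rewrite -[LHS]/(pseries_diffs (coef F Leaf) n) diffs_coef.
rewrite -[tree_expect n.+1 F]/(tree_expect n _) -[RHS]mulrA -IHn -coefZ.
have E t : nleaves t = (nleaves Leaf + n.*2)%N ->
    grow_sum F t = n.*2.+1%:R * ((\sum_(s <- grow t) F s) / (size (grow t))%:R).
  move=> tE; rewrite mulrCA -[n.*2.+1]add1n -tE -size_grow divff ?mulr1 //.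
  exact: size_grow_neq0.
by apply/eqP; rewrite eq_le !coef_le // => t /E ->.
Qed.

(** [coef 1 Leaf n] is the product of the (2i - 1) / i for i <= n, which is of
order 2^n / sqrt n. *)
Lemma coef1_lower n : (0 < n)%N ->
  (2 ^+ n) ^+ 2 <= 4 * n%:R * coef (fun=> 1) Leaf n ^+ 2 :> R.
Proof.
elim: n => // -[|n] IHn _.
  have := coef1_rec R 0; rewrite !mul1r {2}/coef /= fact0 divr1 => ->.
  by rewrite expr1n mulr1 expr1; lra.
have {}IHn := IHn isT.
have n0 : (0 : R) < n.+2%:R by rewrite ltr0n.
have -> : coef (fun=> 1) Leaf n.+2 =
    n.+1.*2.+1%:R / n.+2%:R * coef (fun=> 1) Leaf n.+1 :> R.
  rewrite mulrAC; apply: (canRL (mulfK _)); first by rewrite gt_eqF.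
  by rewrite mulrC coef1_rec.
move: IHn; set c := coef _ _ _; set q := 2 ^+ n.+1 => IHn.
rewrite [2 ^+ n.+2]exprS -/q exprMn.
apply: (@le_trans _ _ (4 * (4 * n.+1%:R * c ^+ 2))).
  have -> : 2 ^+ 2 = 4 :> R by ring.
  by rewrite ler_wpM2l.
have -> : 4 * n.+2%:R * (n.+1.*2.+1%:R / n.+2%:R * c) ^+ 2 =
    4 * (n.+1.*2.+1%:R ^+ 2 / n.+2%:R) * c ^+ 2 :> R.
  by field; rewrite gt_eqF.
rewrite mulrA ler_wpM2r ?sqr_ge0 // ler_wpM2l //.
by rewrite ler_pdivlMr // -natrX -!natrM ler_nat; lia.
Qed.

Lemma bernoulli (a : R) n : 0 <= a -> a <= 1 -> 1 - n%:R * a <= (1 - a) ^+ n.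
Proof.
move=> a0 a1; elim: n => [|n IHn]; first by rewrite expr0 mul0r subr0.
rewrite exprS (le_trans (y := (1 - a) * (1 - n%:R * a))) //; last first.
  by rewrite ler_wpM2l // subr_ge0.
have n0 : 0 <= n%:R * (a * a) by rewrite !mulr_ge0.
rewrite -[n.+1]addn1 natrD; lra.
Qed.

(** The generating function at distance of order 1/N from its singularity bounds
the mean for the single size [N]: by monotonicity the mean is at least as large
for all sizes in [N, 2N), and these sizes carry a positive proportion of the
total mass there. *)
Lemma tree_expect_cap_le : exists2 k : R, 0 < k & forall N : nat, (0 < N)%N ->
  tree_expect N cap <= 64 * N%:R * expR (- k * ln N%:R).
Proof.
have [k k0 grow_k] := gf_cap_growth R.
exists (k / 2); first by rewrite divr_gt0.
move=> N N0; have NR0 : (0 : R) < N%:R by rewrite ltr0n.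
have NR1 : (1 : R) <= N%:R by rewrite ler1n.
(* By Bernoulli's inequality, (1 - 1/(4N))^n >= 1/2 for all n <= 2N. *)
pose a : R := (4 * N%:R)^-1; pose x := (1 - a) / 2.
have aN : a * (4 * N%:R) = 1 by rewrite mulVf // gt_eqF // mulr_gt0.
have a0 : 0 < a by rewrite invr_gt0 mulr_gt0.
have a1 : a <= 1 by rewrite invf_le1 ?mulr_gt0 //; lra.
have x0 : 0 <= x by rewrite divr_ge0 // subr_ge0.
have xlt : x < 1 / 2 by rewrite /x; lra.
pose r := expR (ln (2 * N%:R) / 2) : R.
have r0 : 0 < r := expR_gt0 _.
have rr : r ^+ 2 = 2 * N%:R.
  by rewrite expr2 -expRD -splitr lnK // posrE mulr_gt0.
have term n : (N <= n < N + N)%N ->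
    tree_expect N cap / (4 * r) <= coef cap Leaf n * x ^+ n.
  move=> /andP[Nn n2]; rewrite coef_tree_expect.
  have t0 : 0 <= tree_expect N cap :> R.
    apply: (@le_trans _ _ (tree_expect 0 cap)); first exact: ler01.
    exact: tree_expect_cap_nd.
  have n0 : (0 < n)%N := leq_trans N0 Nn.
  have {}n2 : n%:R <= 2 * N%:R :> R.
    by rewrite -natrM ler_nat mul2n -addnn ltnW.
  have c0 := coef1_ge0 R n.
  have cn : 2 ^+ n <= 2 * r * coef (fun=> 1) Leaf n :> R.
    have B0 : 0 <= 2 * r * coef (fun=> 1) Leaf n.
      by apply: mulr_ge0 c0; apply: mulr_ge0 => //; exact: ltW.
    rewrite -(@ler_pXn2r _ 2) ?nnegrE ?exprn_ge0 //.
    apply: le_trans (coef1_lower n0) _.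
    have -> : (2 * r * coef (fun=> 1) Leaf n) ^+ 2 =
      4 * (2 * N%:R) * coef (fun=> 1) Leaf n ^+ 2 :> R by rewrite -rr; ring.
    by rewrite ler_wpM2r ?sqr_ge0 // ler_wpM2l.
  have xn : 1 / 2 <= 2 ^+ n * x ^+ n.
    rewrite -exprMn; have -> : 2 * x = 1 - a by rewrite /x; field.
    apply: le_trans (bernoulli n (ltW a0) a1).
    have : n%:R * a <= (2 * N%:R) * a by rewrite ler_wpM2r ?(ltW a0).
    lra.
  rewrite ler_pdivrMr ?mulr_gt0 //.
  apply: (@le_trans _ _ (tree_expect n cap)); first exact: tree_expect_cap_nd.
  have tn0 : 0 <= tree_expect n cap :> R.
    by rewrite (le_trans t0) // tree_expect_cap_nd.
  have -> : coef (fun=> 1) Leaf n * tree_expect n cap * x ^+ n * (4 * r) =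
    coef (fun=> 1) Leaf n * x ^+ n * (4 * r) * tree_expect n cap by ring.
  rewrite -[leLHS]mul1r ler_wpM2r //.
  apply: (@le_trans _ _ (2 * (2 ^+ n * x ^+ n))); first by lra.
  have -> : coef (fun=> 1) Leaf n * x ^+ n * (4 * r) =
    2 * (2 * r * coef (fun=> 1) Leaf n * x ^+ n) by ring.
  by rewrite ler_wpM2l // ler_wpM2r // exprn_ge0.
have low_sum : N%:R * (tree_expect N cap / (4 * r)) <= gf cap x.
  apply: le_trans (gf_ge_sum x0 xlt N (N + N) _ _); last 2 first.
  - exact: graded_moderate (@graded_cap R).
  - by move=> t; exact: le_trans ler01 (cap_ge1 R t).
  have -> : N%:R * (tree_expect N cap / (4 * r)) =
      \sum_(N <= i < N + N) tree_expect N cap / (4 * r).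
    by rewrite sumr_const_nat addnK mulr_natl.
  by rewrite big_nat [leRHS]big_nat; apply: ler_sum => n; exact: term.
have gf0 : 0 < gf cap x := gf_cap_gt0 x0 xlt.
have up : gf cap x <= expR ((3 - k) * (ln (4 * N%:R) / 2)).
  rewrite -[leLHS]lnK ?posrE // ler_expR (le_trans (grow_k x x0 xlt)) //.
  have -> : 1 - 2 * x = a by rewrite /x; field.
  by rewrite /a lnV ?posrE ?mulr_gt0 // opprK.
have L4 : ln N%:R <= ln (4 * N%:R) :> R.
  by rewrite ler_ln ?posrE ?mulr_gt0 //; lra.
have rle : r <= expR (ln (4 * N%:R) / 2).
  rewrite ler_expR ler_wpM2r ?invr_ge0 // ler_ln ?posrE ?mulr_gt0 //; lra.
have key : N%:R * tree_expect N cap <=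
    4 * N%:R * (16 * N%:R * expR (- (k / 2) * ln N%:R)).
  apply: (@le_trans _ _ (4 * r * expR ((3 - k) * (ln (4 * N%:R) / 2)))).
    rewrite -ler_pdivrMl ?mulr_gt0 //.
    apply: le_trans (le_trans low_sum up).
    by rewrite le_eqVlt; apply/orP; left; apply/eqP; ring.
  apply: (@le_trans _ _ (4 * (expR (ln (4 * N%:R) / 2) *
      expR ((3 - k) * (ln (4 * N%:R) / 2))))).
    by rewrite -mulrA ler_wpM2l // ler_wpM2r ?expR_ge0.
  have -> : 4 * N%:R * (16 * N%:R * expR (- (k / 2) * ln N%:R)) =
      4 * ((4 * N%:R) * (4 * N%:R) * expR (- (k / 2) * ln N%:R)) :> R by ring.
  have -> : 4 * N%:R = expR (ln (4 * N%:R)) :> R by rewrite lnK // posrE mulr_gt0.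
  rewrite expRK -!expRD ler_wpM2l // ler_expR.
  have : 0 <= k * (ln (4 * N%:R) - ln N%:R) by rewrite mulr_ge0 ?(ltW k0) ?subr_ge0.
  lra.
rewrite -(ler_pM2l NR0) (le_trans key) // le_eqVlt; apply/orP; left.
by apply/eqP; ring.
Qed.

End Average.

(** * The tail of the longest path *)

Lemma apn_expect_ge0 (R : realType) n (F : network -> R) :
  (forall A, 0 <= F A) -> 0 <= apn_expect n F.
Proof.
elim: n F => [|n IHn] F F0 /=; first exact: F0.
by apply: IHn => A; rewrite divr_ge0 // sumr_ge0.
Qed.

(** Markov's inequality; for bounded [h] the right-hand side is a negative power
of [n]. *)
Lemma long_path_prob_le (R : realType) : exists2 k : R, 0 < k &
  forall (n : nat) (h : R), (0 < n)%N ->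
    apn_prob R n (fun A => n%:R * expR (- h) <= (longest_path_length A)%:R)
      <= 128 * expR (h - k * ln n%:R).
Proof.
have [k k0 cap_k] := tree_expect_cap_le R; exists k => // n h n0.
have nR0 : (0 : R) < n%:R by rewrite ltr0n.
pose K : R := n%:R * expR (- h).
have K0 : 0 < K by rewrite mulr_gt0 ?expR_gt0.
apply: (@le_trans _ _ (tree_expect n (fun t => 2 / K * cap t))).
  apply: apn_expect_le_tree_expect => A t /(longest_path_le_cap R) AL.
  have cap1 := cap_ge1 R (shape t).
  rewrite /= -/K; case: (leP K (longest_path_length A)%:R) => [KL|_] /=; last first.
    by rewrite mulr_ge0 ?divr_ge0 ?(ltW K0) // (le_trans ler01).
  by rewrite mulrAC ler_pdivlMr // mul1r (le_trans KL) //; lra.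
rewrite tree_expectZ (le_trans (ler_wpM2l _ (cap_k n n0))) ?divr_ge0 ?(ltW K0) //.
rewrite expRD -mulNr /K expRN invfM invrK le_eqVlt; apply/orP; left; apply/eqP.
by field; rewrite gt_eqF.
Qed.

Lemma powR_sublinear (R : realType) (k c c' : R) : 0 < k ->
  c <= 2 / 3 -> c' <= 2 / 3 ->
  \forall L \near +oo, L `^ c + L `^ c' <= k * L.
Proof.
move=> k0 hc hc'; near=> L.
have L1 : 1 <= L by near: L; exact: nbhs_pinfty_ge.
have L0 : 0 <= L by rewrite (le_trans ler01).
have h1 : L `^ c <= L `^ (2 / 3) by exact: ler_powR.
have h2 : L `^ c' <= L `^ (2 / 3) by exact: ler_powR.
have h3 : 2 / k <= L `^ (1 / 3).
  have kL : (2 / k) `^ 3 <= L by near: L; exact: nbhs_pinfty_ge.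
  have k2 : 0 <= 2 / k by rewrite divr_ge0 // ltW.
  have <- : ((2 / k) `^ 3) `^ (1 / 3) = 2 / k.
    rewrite -powRrM; have -> : 3 * (1 / 3) = 1 :> R by field.
    exact: powRr1.
  by rewrite ge0_ler_powR // nnegrE powR_ge0.
have LE : L = L `^ (2 / 3) * L `^ (1 / 3).
  rewrite -powRD; last by apply/implyP => _; rewrite gt_eqF // (lt_le_trans ltr01).
  have -> : 2 / 3 + 1 / 3 = 1 :> R by field.
  by rewrite powRr1.
have p0 : 0 <= L `^ (2 / 3) := powR_ge0 _ _.
have : L `^ (2 / 3) * (2 / k) <= L by rewrite {2}LE ler_wpM2l.
rewrite mulrA ler_pdivrMr // mulrC [L * k]mulrC => h4.
by apply: le_trans h4; rewrite mulr2n mulrDl !mul1r lerD.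
Unshelve. all: by end_near. Qed.

Theorem theorem2 (R : realType) (c : R) (hc : c < 2 / 3) :
  (fun n : nat => apn_prob R n
     (fun A : network =>
        n%:R * expR (- (ln n%:R `^ c)) <= (longest_path_length A)%:R :> R))
  =O_\oo (fun n : nat => expR (- (ln n%:R `^ (c / 2)))).
Proof.
have [k k0 prob_k] := long_path_prob_le R.
apply/eqO_exP; exists 128; first by rewrite ltr0n.
have [M [_ HM]] : \forall L \near +oo, L `^ c + L `^ (c / 2) <= k * L.
  by apply: powR_sublinear => //; lra.
near=> n.
have n0 : (0 < n)%N by near: n; exact: nbhs_infty_gt.
have LM : M < ln (n%:R : R).
  rewrite -(expRK M) ltr_ln ?posrE ?expR_gt0 ?ltr0n //.
  by near: n; exact: nbhs_infty_gtr.
rewrite ger0_norm; last by apply: apn_expect_ge0 => A; exact: ler0n.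
rewrite ger0_norm ?expR_ge0 //.
apply: le_trans (prob_k n _ n0) _; rewrite ler_wpM2l // ler_expR.
have := HM _ LM; lra.
Unshelve. all: by end_near. Qed.
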